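(* Let $k$ be a field, $R$ a commutative unital $k$-algebra and $s,n\ge1$ integers. The group $((\mathfrak{G}^s)_n(R),\boxtimes)$ is split solvable; that is, $(\mathfrak{G}^s)_n$ admits a finite subnormal series of closed subgroup schemes, $(\mathfrak{G}^s)_n=H_0\supset H_1\supset\dots\supset H_r=\{e\}$, such that for each $i$, $H_{i+1}(R)$ is normal in $H_i(R)$ and the quotient group $H_i(R)/H_{i+1}(R)$ is isomorphic to $\mathbb{G}_a(R)=(R,+)$ or to $\mathbb{G}_m(R)=R^\times$.
   Context: For a commutative unital $k$-algebra $R$, series in $s$ non-commuting variables without constant term are written $f=\sum_{|w|\ge1}X_w(f)z_w$, indexed by non-empty words $w=(i_1\dots i_n)$ in $\{1,\dots,s\}$ of length $|w|=n$, $z_w=z_{i_1}\cdots z_{i_n}$. $\operatorname{NC}(n)$ is the set of non-crossing partitions of $\{1,\dots,n\}$. The Kreweras complement $K(\pi)$ of $\pi\in\operatorname{NC}(n)$ is the maximal (for the order in which $\sigma\le\pi$ iff every block of $\sigma$ lies in a block of $\pi$) non-crossing partition of $\{\bar1,\dots,\bar n\}$ (identified with $\{1,\dots,n\}$) such that $\pi\cup K(\pi)$ is a non-crossing partition of $1<\bar1<2<\dots<n<\bar n$. With $w|V=(i_{v_1}\dots i_{v_m})$ for $V=\{v_1<\dots<v_m\}$ and $X_{w,\pi}(f)=\prod_{V\in\pi}X_{w|V}(f)$, the boxed convolution is $X_w(f\boxtimes g)=\sum_{\pi\in\operatorname{NC}(|w|)}X_{w,\pi}(f)X_{w,K(\pi)}(g)$.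 $(\mathfrak{G}^s)_n(R)=\{\sum_{1\le|w|\le n}\alpha_wz_w:\alpha_w\in R,\ \alpha_i\in R^\times\text{ for }i=1,\dots,s\}$, a group under $\boxtimes$ truncated to words of length $\le n$; $R\mapsto(\mathfrak{G}^s)_n(R)$ is an affine algebraic group scheme over $k$. *)

(* Defs.v *)
(* MathComp + multinomials. *)
From HB Require Import structures.
From mathcomp Require Import all_boot all_order all_algebra.
From mathcomp Require Import mpoly.
Set Implicit Arguments.
Unset Strict Implicit.
Unset Printing Implicit Defensive.
Import GRing.Theory.
Local Open Scope ring_scope.

(* -------------------------------------------------------------------- *)
Section NonCrossing.

(* [pos] gives the linear order with respect to which blocks may not cross. *)
Definition noncrossing (T : finType) (pos : T -> nat) (P : {set {set T}}) :=
  [forall A in P, forall B in P, (A != B) ==>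
    [forall a in A, forall b in B, forall c in A, forall d in B,
      ~~ [&& (pos a < pos b)%N, (pos b < pos c)%N & (pos c < pos d)%N]]].

Variable m : nat.
Implicit Types p q t : {set {set 'I_m}}.

Definition NC p := partition p [set: 'I_m] && noncrossing (@nat_of_ord m) p.

Definition refines q p := [forall A in q, exists B in p, A \subset B].

(* The point i is [inl i] and its barred copy is [inr i]; the positions 2i and
   2i+1 realise the order 1 < 1bar < 2 < 2bar < ... *)
Definition interleaved_pos (x : 'I_m + 'I_m) : nat :=
  match x with inl i => i.*2 | inr i => (i.*2).+1 end.

Definition interleave p q : {set {set 'I_m + 'I_m}} :=
  [set inl @: A | A : {set 'I_m} in p] :|: [set inr @: B | B : {set 'I_m} in q].

Definition kreweras_compatible p q :=
  NC q && noncrossing interleaved_pos (interleave p q).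

Definition is_kreweras p q :=
  kreweras_compatible p q &&
  [forall t, kreweras_compatible p t ==> refines t q].

(* For p in NC(m) exactly one q satisfies [is_kreweras p q], so that the
   default value is never used. *)
Definition kreweras p := odflt p [pick q | is_kreweras p q].

End NonCrossing.

(* -------------------------------------------------------------------- *)
Section BoxedConvolution.
Variables (s : nat) (R : comNzRingType).
Implicit Types (w : seq 'I_s) (f g : seq 'I_s -> R).

Definition subword w (V : {set 'I_(size w)}) : seq 'I_s :=
  [seq tnth (in_tuple w) i | i <- enum V].

Definition coef_part f w (p : {set {set 'I_(size w)}}) : R :=
  \prod_(V in p) f (subword V).

(* A series without constant term is the family of its coefficients X_w; the
   value at the empty word is irrelevant. *)
Definition boxconv f g w : R :=
  \sum_(p : {set {set 'I_(size w)}} | NC p)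
     coef_part f p * coef_part g (kreweras p).

End BoxedConvolution.

(* -------------------------------------------------------------------- *)
Definition word (s n : nat) := {u : n.-bseq 'I_s | (0 < size u)%N}.

(* series truncated to words of length 1..n *)
Definition tseries (s n : nat) (R : Type) := {ffun word s n -> R}.

Section Truncated.
Variables (s n : nat) (R : comNzRingType).
Implicit Types f g : tseries s n R.

(* X_u(f); it is 0 for words of length > n. *)
Definition coef f (u : seq 'I_s) : R :=
  oapp f 0 (obind insub (insub u : option (n.-bseq 'I_s))).

Definition box f g : tseries s n R :=
  [ffun w : word s n => boxconv (coef f) (coef g) (val (val w))].

(* z_1 + ... + z_s *)
Definition box1 : tseries s n R :=
  [ffun w : word s n => (size (val (val w)) == 1)%:R].

End Truncated.

Arguments box1 {s n R}.

Definition map_tseries (s n : nat) (R S : Type) (h : R -> S)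
    (f : tseries s n R) : tseries s n S := [ffun w => h (f w)].

(* -------------------------------------------------------------------- *)
Section AbstractGroups.
Variables (T : Type) (mul : T -> T -> T) (e : T).
Implicit Types H N : T -> Prop.

Record group_on H : Prop := GroupOn {
  group_on_1 : H e;
  group_on_M : forall x y, H x -> H y -> H (mul x y);
  group_on_A : forall x y z, H x -> H y -> H z ->
    mul x (mul y z) = mul (mul x y) z;
  group_on_1x : forall x, H x -> mul e x = x;
  group_on_x1 : forall x, H x -> mul x e = x;
  group_on_V : forall x, H x -> exists y, [/\ H y, mul x y = e & mul y x = e]
}.

Definition subgroup_on N H := (forall x, N x -> H x) /\ group_on N.

Definition normal_on N H := forall x x' y,
  H x -> H x' -> mul x x' = e -> mul x' x = e -> N y -> N (mul (mul x y) x').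

Definition lcoset_on N x : T -> Prop := fun y => exists2 z, N z & y = mul x z.

End AbstractGroups.

(* -------------------------------------------------------------------- *)
Section GroupScheme.
Variables (k : fieldType) (s n : nat).

Definition subfunctor :=
  forall R : comUnitAlgType k, tseries s n R -> Prop.

Definition Gscheme : subfunctor :=
  fun R f => forall i : 'I_s, coef f [:: i] \is a GRing.unit.

(* The coordinate ring of the group scheme is generated by the coordinates
   X_w and by the inverses of X_1, ..., X_s. *)
Definition Gvar : finType := (word s n + 'I_s)%type.

Definition Gvar_val (R : comUnitAlgType k) (f : tseries s n R) (v : Gvar) : R :=
  match v with inl w => f w | inr i => (coef f [:: i])^-1 end.

Definition regular_eval (R : comUnitAlgType k) (f : tseries s n R)
    (P : {mpoly k[#|Gvar|]}) : R :=
  mmap (in_alg R) (fun j => Gvar_val f (enum_val j)) P.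

Definition closed_subscheme (H : subfunctor) :=
  exists I : {mpoly k[#|Gvar|]} -> Prop,
  forall (R : comUnitAlgType k) (f : tseries s n R),
    H R f <-> Gscheme f /\ (forall P, I P -> regular_eval f P = 0).

Definition closed_subgroup_scheme (H : subfunctor) :=
  closed_subscheme H /\
  forall R : comUnitAlgType k,
    subgroup_on (@box s n R) box1 (H R) (@Gscheme R).

(* The group functors Ga and Gm, presented as a subset of R together with the
   group law. *)
Definition Ga_set (R : comUnitAlgType k) : pred R := predT.
Definition Gm_set (R : comUnitAlgType k) : pred R :=
  [pred a | a \is a GRing.unit].

(* An isomorphism, natural in R, from the group of cosets H(R)/N(R) onto
   (A R, op R), given on representatives: x and y have the same image iff
   they have the same coset. *)
Definition quotient_isomorphic (H N : subfunctor)
    (A : forall R : comUnitAlgType k, pred R)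
    (op : forall R : comUnitAlgType k, R -> R -> R) :=
  exists phi : forall R : comUnitAlgType k, tseries s n R -> R,
  (forall R : comUnitAlgType k,
     [/\ forall x, H R x -> A R (phi R x),
         forall a, A R a -> exists2 x, H R x & phi R x = a,
         forall x y, H R x -> H R y ->
           phi R (box x y) = op R (phi R x) (phi R y)
       & forall x y, H R x -> H R y ->
           (phi R x = phi R y <->
            forall z, lcoset_on (@box s n R) (N R) x z <->
                      lcoset_on (@box s n R) (N R) y z)]) /\
  (forall (R S : comUnitAlgType k) (h : {lrmorphism R -> S}) x, H R x ->
     phi S (map_tseries h x) = h (phi R x)).

Definition quotient_Ga (H N : subfunctor) :=
  quotient_isomorphic H N Ga_set (fun R (a b : R) => a + b).

Definition quotient_Gm (H N : subfunctor) :=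
  quotient_isomorphic H N Gm_set (fun R (a b : R) => a * b).

Definition split_solvable :=
  exists (r : nat) (H : nat -> subfunctor),
  [/\ forall (R : comUnitAlgType k) f, H 0%N R f <-> @Gscheme R f,
      forall (R : comUnitAlgType k) f, H r R f <-> f = box1,
      forall i, (i <= r)%N -> closed_subgroup_scheme (H i)
    & forall i, (i < r)%N ->
      [/\ forall (R : comUnitAlgType k) f, H i.+1 R f -> H i R f,
          forall R : comUnitAlgType k,
            normal_on (@box s n R) box1 (H i.+1 R) (H i R)
        & quotient_Ga (H i) (H i.+1) \/ quotient_Gm (H i) (H i.+1)]].

End GroupScheme.

(* Main.v *)
(* Two indices lie in the same block of the Kreweras complement K(p) iff the corresponding
   barred points separate no two points of a block of p; this makes K(p) the kernel of a
   map, and the same recipe inside the blocks of pi defines the relative complement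
   K_pi(sigma) of sigma <= pi. Both iterated products f [x] g [x] h are sums over pairs
   of partitions, matched by the bijection (pi, sigma) |-> (sigma, K_pi(sigma)): it is
   injective because K_{K(sigma)}(K_pi(sigma)) = K(pi) and K is injective, hence bijective
   by counting. In X_w(f [x] g) the coefficient X_w(f) occurs only in X_w(f) prod_i X_{w_i}(g)
   and X_w(g) only in prod_i X_{w_i}(f) X_w(g), all other terms involving strictly shorter
   words. Hence inverses exist, fixing the coefficients of the first i words (in order of
   length) to those of the unit defines a normal subgroup, and the coefficient of the next
   word w maps the quotient of two consecutive subgroups to G_m if |w| = 1 and to G_a
   otherwise. *)
Require Import Defs.
From mathcomp Require Import all_boot all_order all_algebra.
From mathcomp Require Import mpoly zify.
Set Implicit Arguments.
Unset Strict Implicit.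
Unset Printing Implicit Defensive.
Import GRing.Theory.

(** * Partitions and their blocks *)

Section SameBlock.
Variable T : finType.
Implicit Types (p q : {set {set T}}) (x y z : T) (V : {set T}).

(** Crossing, refinement and complement are all expressed through this relation on points, so that
    equality of partitions reduces to equality of relations ([eq_partition_same]). *)
Definition same p x y := [exists A in p, (x \in A) && (y \in A)].

Lemma same_existsP p x y : reflect (exists A, [/\ A \in p, x \in A & y \in A]) (same p x y).
Proof.
apply: (iffP existsP) => [[A /and3P[pA Ax Ay]]|[A [pA Ax Ay]]]; exists A => //.
by rewrite pA Ax.
Qed.

Lemma same_block p A x y : A \in p -> x \in A -> y \in A -> same p x y.
Proof. by move=> pA Ax Ay; apply/same_existsP; exists A. Qed.

Lemma same_sym p x y : same p x y = same p y x.
Proof. by apply/same_existsP/same_existsP => -[A [? ? ?]]; exists A. Qed.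

Lemma trivIset_same p A x y :
  trivIset p -> A \in p -> x \in A -> same p x y = (y \in A).
Proof.
move=> tp pA Ax; apply/idP/idP => [/same_existsP[B [pB Bx By]]|]; last exact: same_block pA Ax.
by rewrite -(def_pblock tp pA Ax) (def_pblock tp pB Bx).
Qed.

Lemma same_mem p V x y : partition p V -> same p x y -> x \in V.
Proof. by move=> pV /same_existsP[A [pA Ax _]]; apply: (subsetP (partitionS pV pA)). Qed.

Lemma same_refl p V x : partition p V -> same p x x = (x \in V).
Proof.
move=> pV; apply/idP/idP=> [|Vx]; first exact: same_mem.
move: Vx; rewrite -(cover_partition pV) => /bigcupP[A pA Ax].
exact: (same_block pA Ax Ax).
Qed.

Lemma partition_sameE p V :
  partition p V -> p = equivalence_partition (same p) V.
Proof.
move=> pV; have tp := partition_trivIset pV.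
apply/setP=> A; apply/idP/imsetP => [pA|[x Vx ->]].
  have /set0Pn[x Ax] := partition_neq0 pV pA.
  exists x; first exact: (subsetP (partitionS pV pA)).
  apply/setP=> y; rewrite inE (trivIset_same y tp pA Ax).
  by case Ay: (y \in A); rewrite ?andbF // (subsetP (partitionS pV pA)).
have /bigcupP[B pB Bx] : x \in cover p by rewrite (cover_partition pV).
suff -> : [set y in V | same p x y] = B by [].
apply/setP=> y; rewrite inE (trivIset_same y tp pB Bx).
by case By: (y \in B); rewrite ?andbF // (subsetP (partitionS pV pB)).
Qed.

Lemma eq_partition_same p q V :
  partition p V -> partition q V -> same p =2 same q -> p = q.
Proof.
move=> pV qV epq; rewrite (partition_sameE pV) (partition_sameE qV).
by apply: eq_imset => x; apply/setP=> y; rewrite !inE epq.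
Qed.

Lemma same_refines p q V :
  partition p V -> partition q V ->
  (forall x y, same p x y -> same q x y) ->
  forall A, A \in p -> exists2 B, B \in q & A \subset B.
Proof.
move=> pV qV spq A pA; have /set0Pn[x Ax] := partition_neq0 pV pA.
have qxx : same q x x by apply/spq/(same_block pA).
have [B [qB Bx _]] := same_existsP _ _ _ qxx.
exists B => //; apply/subsetP=> y Ay.
rewrite -(trivIset_same y (partition_trivIset qV) qB Bx).
exact/spq/(same_block pA).
Qed.

Lemma equivalence_partition_same (R : rel T) V x y :
  {in V & &, equivalence_rel R} ->
  same (equivalence_partition R V) x y = [&& x \in V, y \in V & R x y].
Proof.
move=> eR; have pV := equivalence_partitionP eR.
apply/idP/idP=> [s|/and3P[Vx Vy Rxy]].
  have Vx := same_mem pV s; have Vy : y \in V by move: s; rewrite same_sym => /(same_mem pV).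
  rewrite Vx Vy -(pblock_equivalence_partition eR Vx Vy) /=.
  move/same_existsP: s => [A [pA Ax Ay]].
  by rewrite (def_pblock (partition_trivIset pV) pA Ax).
have Cx : x \in cover (equivalence_partition R V) by rewrite (cover_partition pV).
apply/same_existsP; exists (pblock (equivalence_partition R V) x).
by rewrite pblock_mem // mem_pblock Cx pblock_equivalence_partition.
Qed.

Lemma same_bigcup (I : finType) (P : pred I) (F : I -> {set {set T}}) x y :
  same (\bigcup_(i | P i) F i) x y = [exists i, P i && same (F i) x y].
Proof.
apply/same_existsP/existsP => [[A [/bigcupP[i Pi Ai] Ax Ay]]|
    [i /andP[Pi /same_existsP[A [Ai Ax Ay]]]]].
  by exists i; rewrite Pi; apply: same_block Ai Ax Ay.
by exists A; split=> //; apply/bigcupP; exists i.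
Qed.

(** First half of a dictionary: families of partitions of the blocks of [pi] correspond to
    partitions finer than [pi], by gluing and restricting. [glue_restrict] and [restrict_glue] show
    that the two operations are mutually inverse. *)
Lemma partition_glue (pi : {set {set T}}) V (F : {set T} -> {set {set T}}) :
  partition pi V -> (forall A, A \in pi -> partition (F A) A) ->
  partition (\bigcup_(A in pi) F A) V.
Proof.
move=> piV pF; apply/and3P; split.
- apply/eqP/setP=> x; rewrite -(cover_partition piV); apply/bigcupP/bigcupP.
    case=> B /bigcupP[A piA BA] Bx; exists A => //.
    exact: (subsetP (partitionS (pF A piA) BA)).
  case=> A piA; rewrite -{1}(cover_partition (pF A piA)) => /bigcupP[B BA Bx].
  by exists B => //; apply/bigcupP; exists A.
- apply/trivIsetP=> B B' /bigcupP[A piA BA] /bigcupP[A' piA' BA'].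
  have [eAA|nAA] := eqVneq A A'.
    rewrite -eAA in BA'.
    exact: (trivIsetP (partition_trivIset (pF A piA))).
  move=> _; have := trivIsetP (partition_trivIset piV) _ _ piA piA' nAA.
  apply: disjointW.
    exact: (partitionS (pF _ piA)).
  exact: (partitionS (pF _ piA')).
- by apply/negP=> /bigcupP[A piA]; rewrite (partition0 (pF A piA)).
Qed.

Lemma same_glue (pi : {set {set T}}) V (F : {set T} -> {set {set T}}) x y :
  partition pi V -> (forall A, A \in pi -> partition (F A) A) ->
  same (\bigcup_(A in pi) F A) x y -> same pi x y.
Proof.
move=> piV pF; rewrite same_bigcup => /existsP[A /andP[piA s]].
apply: (same_block piA); first exact: same_mem (pF A piA) s.
by move: s; rewrite same_sym; apply: same_mem (pF A piA).
Qed.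

Lemma same_glue_in (pi : {set {set T}}) V (F : {set T} -> {set {set T}}) A x y :
  partition pi V -> (forall A, A \in pi -> partition (F A) A) ->
  A \in pi -> x \in A -> same (\bigcup_(A in pi) F A) x y = same (F A) x y.
Proof.
move=> piV pF piA Ax; rewrite same_bigcup; apply/existsP/idP => [[B /andP[piB s]]|s].
  have Bx := same_mem (pF B piB) s.
  have tpi := partition_trivIset piV.
  by rewrite -(def_pblock tpi piA Ax) (def_pblock tpi piB Bx).
by exists A; rewrite piA.
Qed.

Lemma glue_restrict (pi : {set {set T}}) V (F : {set T} -> {set {set T}}) A :
  partition pi V -> (forall A, A \in pi -> partition (F A) A) ->
  A \in pi -> (\bigcup_(A in pi) F A) ::&: A = F A.
Proof.
move=> piV pF piA; apply/setP=> B; rewrite inE.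
apply/andP/idP => [[/bigcupP[A' piA' FB] sBA]|FB]; last first.
  split; last exact: (partitionS (pF A piA)).
  by apply/bigcupP; exists A.
have /set0Pn[x Bx] := partition_neq0 (pF _ piA') FB.
have tpi := partition_trivIset piV.
rewrite -(def_pblock tpi piA (subsetP sBA _ Bx)).
by rewrite (def_pblock tpi piA' (subsetP (partitionS (pF _ piA') FB) _ Bx)).
Qed.

(** [sg ::&: A] keeps the blocks of [sg] contained in [A]. They cover [A] because a block of [sg]
    meeting [A] cannot leave it when [sg] is finer than [pi]. *)
Lemma restrict_partition (pi sg : {set {set T}}) V A :
  partition pi V -> partition sg V ->
  (forall x y, same sg x y -> same pi x y) -> A \in pi ->
  partition (sg ::&: A) A.
Proof.
move=> piV sgV ref piA; apply/and3P; split.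
- apply/eqP/setP=> x; apply/bigcupP/idP => [[B]|Ax].
    by rewrite inE => /andP[_ /subsetP]; apply.
  have : x \in V by apply: (subsetP (partitionS piV piA)).
  rewrite -(same_refl _ sgV) => /same_existsP[B [sgB Bx _]].
  exists B => //; rewrite inE sgB; apply/subsetP=> y By.
  rewrite -(trivIset_same y (partition_trivIset piV) piA Ax).
  exact/ref/(same_block sgB).
- exact/trivIsetI/partition_trivIset/sgV.
- by rewrite inE (partition0 sgV).
Qed.

Lemma same_restrict (pi sg : {set {set T}}) V A x y :
  partition pi V -> partition sg V ->
  (forall x y, same sg x y -> same pi x y) -> A \in pi ->
  same (sg ::&: A) x y = (x \in A) && same sg x y.
Proof.
move=> piV sgV ref piA; apply/idP/andP => [/same_existsP[B []]|[Ax /same_existsP[B [sgB Bx By]]]].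
  rewrite inE => /andP[sgB /subsetP sBA] Bx By; split; first exact: sBA.
  exact: same_block sgB _ _.
apply/same_existsP; exists B; split=> //; rewrite inE sgB.
apply/subsetP=> z Bz; rewrite -(trivIset_same z (partition_trivIset piV) piA Ax).
exact/ref/(same_block sgB).
Qed.

Lemma restrict_glue (pi sg : {set {set T}}) V :
  partition pi V -> partition sg V ->
  (forall x y, same sg x y -> same pi x y) ->
  \bigcup_(A in pi) (sg ::&: A) = sg.
Proof.
move=> piV sgV ref; apply/setP=> B; apply/bigcupP/idP => [[A _]|sgB].
  by rewrite inE => /andP[].
have [A piA sBA] := same_refines sgV piV ref sgB.
by exists A => //; rewrite inE sgB.
Qed.

End SameBlock.

(** * The Kreweras complement *)

Section Kreweras.
Variable m : nat.
Implicit Types (p q t pi sg tau : {set {set 'I_m}}) (i j x y z : 'I_m) (V : {set 'I_m}).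

(* The barred point [i] lies cyclically between the points [x] and [y]. *)
Definition sep i x y := (i < x) (+) (i < y).

(** No chord joining two points of a block of [p] separates the barred points of [i] and [j]. *)
Definition kreweras_rel p i j := [forall x, forall y, same p x y ==> (sep i x y == sep j x y)].

Lemma kreweras_relP p i j :
  reflect (forall x y, same p x y -> x < y -> sep i x y = sep j x y) (kreweras_rel p i j).
Proof.
apply: (iffP forallP) => [h x y s _|h x].
  by move: (h x) => /forallP/(_ y); rewrite s => /eqP.
apply/forallP=> y; apply/implyP=> s; apply/eqP.
case: (ltngtP x y) => [|lt|/val_inj->]; first exact: h.
  by rewrite /sep ![(_ < x) (+) _]addbC; apply: h; rewrite // same_sym.
by rewrite /sep !addbb.
Qed.

Lemma kreweras_rel_equiv p V : {in V & &, equivalence_rel (kreweras_rel p)}.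
Proof.
move=> x y z _ _ _; split; first by apply/kreweras_relP.
move=> /kreweras_relP h; apply/kreweras_relP/kreweras_relP=> h' a b s l.
  by rewrite -h // h'.
by rewrite h // h'.
Qed.

Definition kreweras_on V p := equivalence_partition (kreweras_rel p) V.

Lemma partition_kreweras_on V p : partition (kreweras_on V p) V.
Proof. exact/equivalence_partitionP/kreweras_rel_equiv. Qed.

Lemma same_kreweras_on V p x y :
  same (kreweras_on V p) x y = [&& x \in V, y \in V & kreweras_rel p x y].
Proof. exact/equivalence_partition_same/kreweras_rel_equiv. Qed.

Lemma noncrossingP p : trivIset p ->
  reflect (forall a b c d, same p a c -> same p b d ->
             a < b -> b < c -> c < d -> same p a b)
          (noncrossing (@nat_of_ord m) p).
Proof.
move=> tp; apply: (iffP idP) => [nc a b c d|nc].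
  move=> /same_existsP[A [pA Aa Ac]] /same_existsP[B [pB Bb Bd]] ab bc cd.
  case: (eqVneq A B) => [eAB|nAB]; first by apply: same_block pA Aa _; rewrite eAB.
  move: nc => /'forall_implyP/(_ A pA)/'forall_implyP/(_ B pB)/implyP/(_ nAB).
  move=> /'forall_implyP/(_ a Aa)/'forall_implyP/(_ b Bb).
  move=> /'forall_implyP/(_ c Ac)/'forall_implyP/(_ d Bd).
  by rewrite ab bc cd.
apply/'forall_implyP=> A pA; apply/'forall_implyP=> B pB; apply/implyP=> nAB.
apply/'forall_implyP=> a Aa; apply/'forall_implyP=> b Bb.
apply/'forall_implyP=> c Ac; apply/'forall_implyP=> d Bd.
apply: contra nAB => /and3P[ab bc cd]; apply/eqP.
have := nc a b c d (same_block pA Aa Ac) (same_block pB Bb Bd) ab bc cd.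
rewrite (trivIset_same b tp pA Aa) => Ab.
by rewrite -(def_pblock tp pA Ab) (def_pblock tp pB Bb).
Qed.

Definition NCon V p := partition p V && noncrossing (@nat_of_ord m) p.

Lemma NConP V p : reflect (partition p V /\
   (forall a b c d, same p a c -> same p b d ->
             a < b -> b < c -> c < d -> same p a b)) (NCon V p).
Proof.
apply: (iffP andP) => -[pV nc]; split=> //.
  by apply/noncrossingP; first exact: partition_trivIset pV.
by apply/noncrossingP; first exact: partition_trivIset pV.
Qed.

(** For [x < y], [sep i x y] says that [x <= i < y]. An interval containing [a] and [c] contains
    [b], and one containing [b] and [d] contains [c]; so related pairs that cross are all
    related. *)
Lemma NCon_kreweras_on V p : NCon V (kreweras_on V p).
Proof.
apply/NConP; split; first exact: partition_kreweras_on.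
move=> a b c d; rewrite !same_kreweras_on => /and3P[-> _ /kreweras_relP ac]
  /and3P[-> _ /kreweras_relP bd] ab bc cd /=.
apply/kreweras_relP=> x y s l; have := ac x y s l; have := bd x y s l.
by rewrite /sep; clear -ab bc cd l; lia.
Qed.

Lemma NC_kreweras_on p : NC (kreweras_on setT p).
Proof. exact: (NCon_kreweras_on setT p). Qed.

(** Of the four cases, two are the non-crossing property of [p] and of its complement. In the two
    mixed ones, a crossing would be a chord of [p] separating two related barred points. *)
Lemma kreweras_compatible_kreweras_on p : NC p -> kreweras_compatible p (kreweras_on setT p).
Proof.
move=> ncp; apply/andP; split; first exact: NCon_kreweras_on.
have /andP[pK ncK] := NCon_kreweras_on setT p; have /andP[pp ncp'] := ncp.
apply/'forall_implyP=> A0 /setUP[] /imsetP[A pA ->];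
  apply/'forall_implyP=> B0 /setUP[] /imsetP[B pB ->]; apply/implyP=> nAB;
  apply/'forall_implyP=> _ /imsetP[a Aa ->]; apply/'forall_implyP=> _ /imsetP[b Bb ->];
  apply/'forall_implyP=> _ /imsetP[c Ac ->]; apply/'forall_implyP=> _ /imsetP[d Bd ->] /=.
- have {}nAB : A != B by apply: contraNneq nAB => ->.
  move: ncp' => /'forall_implyP/(_ A pA)/'forall_implyP/(_ B pB)/implyP/(_ nAB).
  move=> /'forall_implyP/(_ a Aa)/'forall_implyP/(_ b Bb).
  move=> /'forall_implyP/(_ c Ac)/'forall_implyP/(_ d Bd).
  by rewrite ?ltnS !ltn_double.
- have /and3P[_ _ /kreweras_relP k] : [&& b \in setT, d \in setT & kreweras_rel p b d].
    by rewrite -same_kreweras_on; apply: same_block Bb Bd.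
  rewrite ltnS leq_double !ltn_Sdouble; apply/negP=> /and3P[ab bc cd].
  by have := k a c (same_block pA Aa Ac); rewrite /sep; clear -ab bc cd; lia.
- have /and3P[_ _ /kreweras_relP k] : [&& a \in setT, c \in setT & kreweras_rel p a c].
    by rewrite -same_kreweras_on; apply: same_block Aa Ac.
  rewrite ltnS leq_double !ltn_Sdouble; apply/negP=> /and3P[ab bc cd].
  by have := k b d (same_block pB Bb Bd); rewrite /sep; clear -ab bc cd; lia.
- have {}nAB : A != B by apply: contraNneq nAB => ->.
  move: ncK => /'forall_implyP/(_ A pA)/'forall_implyP/(_ B pB)/implyP/(_ nAB).
  move=> /'forall_implyP/(_ a Aa)/'forall_implyP/(_ b Bb).
  move=> /'forall_implyP/(_ c Ac)/'forall_implyP/(_ d Bd).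
  by rewrite ?ltnS !ltn_double.
Qed.

(** A chord of [p] separating two barred points of one block of [t] would be a crossing in the
    interleaved order. *)
Lemma kreweras_compatible_refines p t :
  kreweras_compatible p t -> forall x y, same t x y -> same (kreweras_on setT p) x y.
Proof.
move=> /andP[/andP[pt nct] nci] x0 y0 /same_existsP[B [tB Bx0 By0]]; rewrite same_kreweras_on !inE /=.
(* Two patterns, according to whether the unbarred or the barred block comes first. The weak
   inequalities arise because the barred copy of a point follows that point. *)
have cross A a b c d : A \in p -> a \in A -> c \in A -> b \in B -> d \in B ->
    ~~ [&& a <= b, b < c & c <= d] && ~~ [&& b < a, a <= d & d < c].
  move=> pA Aa Ac Bb Bd.
  have iA : inl @: A \in interleave p t by apply/setUP; left; apply: imset_f.
  have iB : inr @: B \in interleave p t by apply/setUP; right; apply: imset_f.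
  have nAB : inl @: A != inr @: B :> {set 'I_m + 'I_m}.
    apply/eqP=> /setP/(_ (inl a)); rewrite imset_f //.
    by move=> /esym/imsetP[].
  apply/andP; split.
    move: nci => /'forall_implyP/(_ _ iA)/'forall_implyP/(_ _ iB)/implyP/(_ nAB).
    move=> /'forall_implyP/(_ _ (imset_f inl Aa))/'forall_implyP/(_ _ (imset_f inr Bb)).
    move=> /'forall_implyP/(_ _ (imset_f inl Ac))/'forall_implyP/(_ _ (imset_f inr Bd)) /=.
    by rewrite !ltnS !leq_double !ltn_Sdouble.
  rewrite eq_sym in nAB.
  move: nci => /'forall_implyP/(_ _ iB)/'forall_implyP/(_ _ iA)/implyP/(_ nAB).
  move=> /'forall_implyP/(_ _ (imset_f inr Bb))/'forall_implyP/(_ _ (imset_f inl Aa)).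
  move=> /'forall_implyP/(_ _ (imset_f inr Bd))/'forall_implyP/(_ _ (imset_f inl Ac)) /=.
  by rewrite !ltnS !leq_double !ltn_Sdouble.
apply/kreweras_relP=> x y /same_existsP[A [pA Ax Ay]] l; rewrite /sep.
have := cross A x x0 y y0 pA Ax Ay Bx0 By0.
have := cross A x y0 y x0 pA Ax Ay By0 Bx0.
by clear -l; lia.
Qed.

(** [kreweras_on setT p] satisfies the specification, so the choice in [kreweras] succeeds; two
    maximal compatible partitions refine each other and are equal. *)
Lemma krewerasE p : NC p -> kreweras p = kreweras_on setT p.
Proof.
move=> ncp; have cK := kreweras_compatible_kreweras_on ncp.
have ref t : kreweras_compatible p t -> refines t (kreweras_on setT p).
  move=> ct; have /andP[/andP[pt _] _] := ct.
  apply/'forall_implyP=> A tA.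
  have [B KB sAB] := same_refines pt (partition_kreweras_on _ _)
    (kreweras_compatible_refines ct) tA.
  by apply/existsP; exists B; rewrite KB.
rewrite /kreweras; case: pickP => [q /andP[cq /forallP maxq]|/(_ (kreweras_on setT p))]; last first.
  by rewrite /is_kreweras cK /=; case/negP; apply/forallP=> t; apply/implyP/ref.
have /andP[/andP[pq _] _] := cq.
apply: (eq_partition_same pq (partition_kreweras_on _ _)) => x y /=.
apply/idP/idP; first exact: kreweras_compatible_refines.
move=> /same_existsP[A [KA Ax Ay]].
move/implyP: (maxq (kreweras_on setT p)) => /(_ cK) /'forall_implyP/(_ A KA).
move=> /existsP[B /andP[qB /subsetP sAB]].
exact: same_block qB (sAB _ Ax) (sAB _ Ay).
Qed.

End Kreweras.

(** * Injectivity of the Kreweras complement on non-crossing partitions *)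

Section KrewerasInjective.
Variable m : nat.
Implicit Types (p q t pi sg tau : {set {set 'I_m}}) (i j x y z : 'I_m) (V : {set 'I_m}).

Lemma sep_pred (c : 'I_m) : exists y, forall u v, sep y u v = (c <= u) (+) (c <= v).
Proof.
(* The witness is the cyclic predecessor of [c]. When [c] is the first index this is the last one,
   and both sides are false. *)
have ltm : (if nat_of_ord c is 0 then m.-1 else c.-1) < m.
  by case: c => [[|c]] /=; lia.
exists (Ordinal ltm) => u v; have := ltn_ord u; have := ltn_ord v; rewrite /sep /= {ltm}.
by case: (nat_of_ord c) => [|c'] /=; lia.
Qed.

(* [c] is the cyclic successor of [x] in its block. *)
Lemma sep_successor p A x c : NC p -> A \in p -> x \in A -> c \in A ->
  (x < c /\ forall z, z \in A -> (z <= x) || (c <= z)) \/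
  (forall z, z \in A -> c <= z <= x) ->
  forall u v, same p u v -> u < v -> sep x u v = (c <= u) (+) (c <= v).
Proof.
move=> /NConP[pp nc] pA Ax Ac gap u v uv lt; rewrite /sep.
have tp := partition_trivIset pp.
have uvA : (u \in A) = (v \in A).
  apply/idP/idP => [Au|Av]; first by rewrite -(trivIset_same v tp pA Au).
  by rewrite -(trivIset_same u tp pA Av) same_sym.
have nAu z : z \in A -> u \notin A -> (z != u :> nat) && (z != v :> nat).
  move=> Az nAu; apply/andP; split; apply: contraNneq nAu => /val_inj e.
    by rewrite -e.
  by rewrite uvA -e.
have sAu z : z \in A -> u \notin A -> same p z u = false.
  by move=> Az; rewrite (trivIset_same _ tp pA Az) => /negbTE.
have sAv z : z \in A -> u \notin A -> same p u z = false.
  by move=> Az nA; rewrite same_sym sAu.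
have xc : same p x c by apply: same_block pA Ax Ac.
case: (boolP (u \in A)) => Au.
  have Av : v \in A by rewrite -uvA.
  case: gap => [[ltxc gap]|gap]; have := gap u Au; have := gap v Av.
    by clear -ltxc lt; lia.
  by clear -lt; lia.
have cx : same p c x by rewrite same_sym.
(* Off the block [A], the chord from [u] to [v] cannot cross the one from [x] to [c]; these are the
   four orders in which it could. *)
have h1 := nc x u c v xc uv; have h2 := nc u x v c uv xc.
have h3 := nc c u x v cx uv; have h4 := nc u c v x uv cx.
rewrite !(sAu _ _ Au) // in h1 h3; rewrite !(sAv _ _ Au) // in h2 h4.
have := nAu x Ax Au; have := nAu c Ac Au.
case: gap => [[ltxc _]|/(_ x Ax)]; first by clear -ltxc lt h1 h2 h3 h4; lia.
by clear -lt h1 h2 h3 h4; lia.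
Qed.

(** This recovers [p] from its complement. If [j] were outside the block [A] of [i], let [x] be the
    last point of [A] before [j] and [c] its cyclic successor in [A]. The barred points of [x] and
    of the predecessor of [c] are related by [sep_successor], yet [i] and [j] separate them. *)
Lemma same_of_kreweras_rel p i j : NC p ->
  (forall x y, kreweras_rel p x y -> sep x i j = sep y i j) -> i < j -> same p i j.
Proof.
move=> ncp h ij; have /NConP[pp _] := ncp; have tp := partition_trivIset pp.
have : same p i i by rewrite (same_refl _ pp) inE.
move=> /same_existsP[A [pA Ai _]]; rewrite (trivIset_same j tp pA Ai).
apply: contraT => nAj.
have [x /andP[Ax xj] maxx] := @arg_maxnP _ i (fun x => (x \in A) && (x < j)) (@nat_of_ord m)
  (introT andP (conj Ai ij)).
have ix : i <= x by apply: maxx; rewrite Ai.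
(* [c] is the least point of [A] beyond [j], or the least point of [A] if none lies beyond. Either
   way [c] is not in the range from [i] (excluded) to [j], which gives the last equation. *)
have [c [Ac gap cij]] : exists c, [/\ c \in A,
    (x < c /\ forall z, z \in A -> (z <= x) || (c <= z)) \/
    (forall z, z \in A -> c <= z <= x) & (c <= i) = (c <= j)].
  have neq z : z \in A -> z != j :> nat.
    by move=> Az; apply: contraNneq nAj => /val_inj <-.
  case: (pickP (fun z => (z \in A) && (j < z))) => [z0 z0P|noz].
    have [c /andP[Ac jc] minc] := @arg_minnP _ z0 (fun z => (z \in A) && (j < z))
      (@nat_of_ord m) z0P.
    exists c; split=> //; last by clear -jc ij; lia.
    left; split=> [|z Az]; first by apply: ltn_trans jc.
    have := maxx z; have := minc z; have := neq z Az; rewrite Az /=; clear; lia.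
  have [c Ac minc] := @arg_minnP _ i (fun z => z \in A) (@nat_of_ord m) Ai.
  exists c; split=> //; last by have := minc i Ai; clear -ij; lia.
  right=> z Az; have := maxx z; have := neq z Az; have := noz z; have := minc z Az.
  by rewrite Az /=; clear; lia.
have [y yP] := sep_pred c.
have /h : kreweras_rel p x y.
  by apply/kreweras_relP=> u v uv lt; rewrite yP; apply: (sep_successor ncp pA Ax Ac gap).
by rewrite yP cij addbb /sep; clear -ix xj ij; lia.
Qed.

Lemma same_kreweras_rel p i j x y : same p i j -> kreweras_rel p x y -> sep x i j = sep y i j.
Proof.
move=> s k; case: (ltngtP i j) => [lt|lt|/val_inj->]; last by rewrite /sep !addbb.
  exact: (kreweras_relP _ _ _ k).
by rewrite /sep ![(_ < i) (+) _]addbC; apply: (kreweras_relP _ _ _ k); rewrite // same_sym.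
Qed.

(** [same_kreweras_rel] and [same_of_kreweras_rel] together characterise the blocks of a
    non-crossing [p] by [kreweras_rel p] alone. *)
Lemma kreweras_on_inj p q : NC p -> NC q -> kreweras_on setT p = kreweras_on setT q -> p = q.
Proof.
move=> ncp ncq eK; have /andP[pp _] := ncp; have /andP[pq _] := ncq.
have ekr x y : kreweras_rel p x y = kreweras_rel q x y.
  by have := same_kreweras_on setT p x y; rewrite eK same_kreweras_on !inE.
apply: (eq_partition_same pp pq) => i j.
have main p' q' i' j' : NC p' -> NC q' -> kreweras_rel p' =2 kreweras_rel q' ->
    i' < j' -> same p' i' j' -> same q' i' j'.
  move=> nc1 nc2 e lt s; apply: same_of_kreweras_rel => // x y; rewrite -e.
  exact: same_kreweras_rel.
case: (ltngtP i j) => [lt|lt|/val_inj->]; last by rewrite (same_refl _ pp) (same_refl _ pq).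
  by apply/idP/idP; apply: main.
by rewrite ![same _ i j]same_sym; apply/idP/idP; apply: main.
Qed.

End KrewerasInjective.

(** * Relative complements *)

Section RelativeKreweras.
Variable m : nat.
Implicit Types (p q pi sg tau : {set {set 'I_m}}) (i j x y z : 'I_m) (V : {set 'I_m}).

Definition finer sg pi := [forall x, forall y, same sg x y ==> same pi x y].

Lemma finerP sg pi : reflect (forall x y, same sg x y -> same pi x y) (finer sg pi).
Proof.
apply: (iffP forallP) => [h x y|h x]; first by move: (h x) => /forallP/(_ y)/implyP.
by apply/forallP=> y; apply/implyP/h.
Qed.

Lemma NCon_glue V pi (F : {set 'I_m} -> {set {set 'I_m}}) :
  NCon V pi -> (forall A, A \in pi -> NCon A (F A)) ->
  NCon V (\bigcup_(A in pi) F A).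
Proof.
move=> /NConP[ppi nc] ncF.
have pF A : A \in pi -> partition (F A) A by move=> /ncF/andP[].
have tpi := partition_trivIset ppi.
apply/NConP; split=> [|a b c d ac bd ab bc cd]; first exact: partition_glue.
have ac' := same_glue ppi pF ac; have bd' := same_glue ppi pF bd.
have /same_existsP[A [piA Aa Ab]] := nc a b c d ac' bd' ab bc cd.
move: ac bd; rewrite !(same_glue_in _ ppi pF piA) //.
by have /NConP[_ ncA] := ncF A piA; move=> ac bd; apply: ncA bc cd.
Qed.

Lemma NCon_restrict V pi sg A : partition pi V -> NCon V sg -> finer sg pi ->
  A \in pi -> NCon A (sg ::&: A).
Proof.
move=> ppi /NConP[psg nc] /finerP ref piA; apply/NConP; split.
  exact: restrict_partition ppi psg ref piA.
move=> a b c d; rewrite !(same_restrict _ _ ppi psg ref piA).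
by move=> /andP[-> ac] /andP[_ bd] ab bc cd; apply: nc bc cd.
Qed.

Definition relative_kreweras pi sg := \bigcup_(A in pi) kreweras_on A (sg ::&: A).

Lemma NC_relative_kreweras pi sg : NC pi -> NC (relative_kreweras pi sg).
Proof. by move=> ncpi; apply: (NCon_glue ncpi) => A _; apply: NCon_kreweras_on. Qed.

Lemma same_relative_kreweras V pi sg A x y :
  partition pi V -> A \in pi -> x \in A ->
  same (relative_kreweras pi sg) x y = (y \in A) && kreweras_rel (sg ::&: A) x y.
Proof.
move=> ppi piA Ax; have pF B : B \in pi -> partition (kreweras_on B (sg ::&: B)) B.
  by move=> _; apply: partition_kreweras_on.
by rewrite (same_glue_in _ ppi pF piA Ax) same_kreweras_on Ax.
Qed.

Lemma relative_kreweras_finer V pi sg : partition pi V -> finer (relative_kreweras pi sg) pi.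
Proof.
move=> ppi; apply/finerP=> x y; apply: (same_glue ppi) => A _.
exact: partition_kreweras_on.
Qed.

(** Let [A] be the block of [pi] containing [x] and [y]. Chords of [sg] inside [A] do not separate
    them by construction; a chord outside [A] lies in another block of [pi], and since [pi] is
    non-crossing it leaves all of [A] on one side. *)
Lemma relative_kreweras_finer_kreweras_on pi sg :
  NC pi -> NC sg -> finer sg pi -> finer (relative_kreweras pi sg) (kreweras_on setT sg).
Proof.
move=> ncpi ncsg ref; have /NConP[ppi nc] := ncpi; have /andP[psg _] := ncsg.
have tpi := partition_trivIset ppi.
apply/finerP=> x y s; rewrite same_kreweras_on !inE /=.
have /same_existsP[A [piA Ax Ay]] := finerP _ _ (relative_kreweras_finer sg ppi) _ _ s.
move: s; rewrite (same_relative_kreweras _ _ ppi piA Ax) => /andP[_ /kreweras_relP k].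
apply/kreweras_relP=> u v uv lt; have [Au|nAu] := boolP (u \in A).
  by apply: k => //; rewrite (same_restrict _ _ ppi psg (finerP _ _ ref) piA) Au.
have uv' := finerP _ _ ref _ _ uv.
have nA z w : z \in A -> w = u \/ w = v -> same pi z w = false.
  move=> Az zw; rewrite (trivIset_same _ tpi piA Az); apply: contraNF nAu => Aw.
  rewrite -(trivIset_same _ tpi piA Aw); case: zw => -> //.
    by rewrite (same_refl _ ppi) inE.
  by rewrite same_sym.
have neq z w : z \in A -> w = u \/ w = v -> z != w :> nat.
  move=> Az zw; apply: contraFneq (nA z w Az zw) => /val_inj ->.
  by rewrite (same_refl _ ppi) inE.
have main z w : z \in A -> w \in A -> z < w -> sep z u v = sep w u v.
  move=> Az Aw zw.
  have zw' : same pi z w by apply: same_block piA Az Aw.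
  have h1 : ~~ [&& z < u, u < w & w < v].
    by apply/negP=> /and3P[l1 l2 l3]; have := nc _ _ _ _ zw' uv' l1 l2 l3; rewrite nA //; left.
  have h2 : ~~ [&& u < z, z < v & v < w].
    apply/negP=> /and3P[l1 l2 l3]; have := nc _ _ _ _ uv' zw' l1 l2 l3.
    by rewrite same_sym nA //; left.
  have := neq z u Az (or_introl erefl); have := neq z v Az (or_intror erefl).
  have := neq w u Aw (or_introl erefl); have := neq w v Aw (or_intror erefl).
  by clear -h1 h2 zw lt; rewrite /sep; lia.
by case: (ltngtP x y) => [l|l|/val_inj-> //]; rewrite (main _ _ _ _ l).
Qed.

Lemma kreweras_rel_finer pi sg i j : finer sg pi -> kreweras_rel pi i j -> kreweras_rel sg i j.
Proof. by move=> /finerP ref /kreweras_relP k; apply/kreweras_relP=> u v uv; apply/k/ref. Qed.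

(** Suppose a block [A] of [pi] met both the interval [i < z <= j] and its complement. Let [x] be
    the last point of [A] in the interval and [y] the point of [A] cyclically preceding it. Chords
    of [sg] respect the interval, so [x] and [y] are related in [relative_kreweras pi sg]; but
    exactly one of them lies in the interval, against the hypothesis on [i] and [j]. *)
Lemma relative_kreweras_saturated pi sg i j u v :
  NC pi -> NC sg -> finer sg pi -> i < j -> kreweras_rel sg i j ->
  (forall x y, same (relative_kreweras pi sg) x y -> kreweras_rel sg j x ->
     sep i x y = sep j x y) ->
  same pi u v -> i < u <= j -> i < v <= j.
Proof.
move=> ncpi ncsg ref lij kij kW uv iu.
have /NConP[ppi nc] := ncpi; have /andP[psg _] := ncsg.
have tpi := partition_trivIset ppi.
have /same_existsP[A [piA Au Av]] := uv.
apply: contraT => nv.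
have [x /andP[Ax ix] maxx] := @arg_maxnP _ u (fun x => (x \in A) && (i < x <= j))
  (@nat_of_ord m) (introT andP (conj Au iu)).
(* [y] is the last point of [A] up to [i], or else the last point of [A] altogether; the bit [b]
   records this wrap-around. On [A], the pair [x], [y] cuts exactly as the interval does. *)
have [y [Ay iy xyA]] : exists y, [/\ y \in A, ~~ (i < y <= j) &
    exists b, forall s, s \in A -> (x < s) (+) (y < s) = b (+) (i < s <= j)].
  case: (pickP (fun z => (z \in A) && (z <= i))) => [z0 z0P|noz].
    have [y /andP[Ay yi] maxy] := @arg_maxnP _ z0 (fun z => (z \in A) && (z <= i))
      (@nat_of_ord m) z0P.
    exists y; split=> //; first by clear -yi; lia.
    exists false => s As; have := maxx s; have := maxy s; rewrite As /=.
    clear -yi ix; lia.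
  have [y Ay maxy] := @arg_maxnP _ v (fun z => z \in A) (@nat_of_ord m) Av.
  have vy := maxy v Av; have := noz v; rewrite Av /= => nvi.
  exists y; split=> //; first by clear -nv nvi vy; lia.
  exists true => s As; have := maxx s; have := maxy s As; have := noz s; rewrite As /=.
  clear -nv nvi vy ix; lia.
have xy : same pi x y by apply: same_block piA Ax Ay.
have ins s t : same sg s t -> (i < s <= j) = (i < t <= j).
  by move=> /same_kreweras_rel/(_ kij); rewrite /sep; clear -lij; lia.
have txy : same (relative_kreweras pi sg) x y.
  rewrite (same_relative_kreweras _ _ ppi piA Ax) Ay /=; apply/kreweras_relP=> s t.
  rewrite (same_restrict _ _ ppi psg (finerP _ _ ref) piA) => /andP[As st] _.
  have At : t \in A by rewrite -(trivIset_same _ tpi piA As); apply: (finerP _ _ ref).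
  have [b bP] := xyA; have := bP s As; have := bP t At; rewrite (ins s t st) /sep.
  by move=> <-; clear; case: (x < s) (x < t) (y < s) (y < t) => [] [] [] [].
(* A chord of [sg] leaving the range from [x] (excluded) to [j] would stay in the larger interval
   and avoid [A], hence cross the chord from [x] to [y]. This yields the relation between [j] and
   [x] that [kW] requires. *)
have xj s t : same sg s t -> x < s <= j -> x < t <= j.
  move=> st xs; have it := ins s t st; apply: contraT => xt.
  have st' : same pi s t by apply: (finerP _ _ ref).
  have nAs : s \notin A by apply/negP=> As; have := maxx s; rewrite As /=; clear -xs ix; lia.
  have nAt : t \notin A.
    by apply: contra nAs => At; rewrite -(trivIset_same s tpi piA At) same_sym.
  have tx : t != x :> nat by apply: contraNneq nAt => /val_inj ->.
  have ltx : i < t < x by clear -it tx xt xs ix; lia.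
  case/andP: xs => xs sj.
  case/andP: ltx => lit ltx; rewrite same_sym in st'.
  case: (leqP y i) => lyi.
    rewrite same_sym in xy.
    have := nc _ _ _ _ xy st' (leq_ltn_trans lyi lit) ltx xs.
    by rewrite (trivIset_same _ tpi piA Ay) (negbTE nAt).
  have sy : s < y by clear -iy lyi sj; lia.
  have := nc _ _ _ _ st' xy ltx xs sy.
  by rewrite same_sym (trivIset_same _ tpi piA Ax) (negbTE nAt).
have /(kW _ _ txy) : kreweras_rel sg j x.
  apply/kreweras_relP=> s t st _; have := xj _ _ st; rewrite same_sym in st; have := xj _ _ st.
  by clear -ix; rewrite /sep; lia.
by rewrite /sep; clear -ix iy; lia.
Qed.

(** Points related in the complement of [pi] are related on the left, since the chords of [sg] and
    of [relative_kreweras pi sg] are among those of [pi]. The converse is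
    [relative_kreweras_saturated], applied to [i] and [j] in increasing order. *)
Lemma relative_kreweras_relative_kreweras pi sg : NC pi -> NC sg -> finer sg pi ->
  relative_kreweras (kreweras_on setT sg) (relative_kreweras pi sg) = kreweras_on setT pi.
Proof.
move=> ncpi ncsg ref; have /NConP[ppi nc] := ncpi; have /andP[psg _] := ncsg.
have tpi := partition_trivIset ppi.
have pKs := partition_kreweras_on setT sg.
have /andP[ptau _] := NC_relative_kreweras sg ncpi.
have reft := relative_kreweras_finer_kreweras_on ncpi ncsg ref.
have /andP[prho _] := NC_relative_kreweras (relative_kreweras pi sg) (NCon_kreweras_on setT sg).
apply: (eq_partition_same prho (partition_kreweras_on _ _)) => i j.
have : same (kreweras_on setT sg) i i by rewrite (same_refl _ pKs) inE.
move=> /same_existsP[W [KW Wi _]].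
have WE x : (x \in W) = kreweras_rel sg i x.
  by rewrite -(trivIset_same x (partition_trivIset pKs) KW Wi) same_kreweras_on !inE.
rewrite (same_relative_kreweras _ _ pKs KW Wi) same_kreweras_on !inE WE /=.
apply/andP/idP => [[kij kW]|kij]; last first.
  split; first exact: kreweras_rel_finer ref kij.
  apply/kreweras_relP=> u v; rewrite (same_restrict _ _ pKs ptau (finerP _ _ reft) KW).
  by move=> /andP[_ /(finerP _ _ (relative_kreweras_finer sg ppi))]; apply/kreweras_relP.
have {kW} : forall u v, same (relative_kreweras pi sg) u v -> kreweras_rel sg i u ->
    sep i u v = sep j u v.
  move=> u v uv; rewrite -WE => Wu; apply: same_kreweras_rel kW.
  by rewrite (same_restrict _ _ pKs ptau (finerP _ _ reft) KW) Wu.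
move=> kW.
have sat i' j' u v : kreweras_rel sg i i' -> kreweras_rel sg i j' -> i' < j' ->
    (forall x y, same (relative_kreweras pi sg) x y -> kreweras_rel sg j' x ->
      sep i' x y = sep j' x y) ->
    same pi u v -> (i' < u <= j') = (i' < v <= j').
  move=> ki kj lt kW' uv; have kij' : kreweras_rel sg i' j'.
    by have [_ /(_ ki) <-] := @kreweras_rel_equiv _ sg setT i i' j'
      (in_setT _) (in_setT _) (in_setT _).
  apply/idP/idP; first exact: relative_kreweras_saturated kW' uv.
  by apply: relative_kreweras_saturated kW' _ => //; rewrite same_sym.
have krji z : kreweras_rel sg j z = kreweras_rel sg i z.
  by have [_ /(_ kij) <-] := @kreweras_rel_equiv _ sg setT i j z
    (in_setT _) (in_setT _) (in_setT _).
have kii : kreweras_rel sg i i by apply/kreweras_relP.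
apply/kreweras_relP=> u v uv luv; rewrite /sep; case: (ltngtP i j) => [lij|lij|/val_inj-> //].
  have : (i < u <= j) = (i < v <= j) by apply: sat uv => // x y; rewrite krji; apply: kW.
  by clear -lij; lia.
have : (j < u <= i) = (j < v <= i) by apply: sat uv => // x y s k; rewrite -kW.
by clear -lij; lia.
Qed.

End RelativeKreweras.

(** * The bijection behind associativity *)

Section TriplesBijection.
Variable m : nat.
Definition finer_pairs :=
  [set x : {set {set 'I_m}} * {set {set 'I_m}} | NC x.1 && (NC x.2 && finer x.2 x.1)].

Lemma relative_kreweras_inj :
  {in finer_pairs &, injective (fun x => (x.2, relative_kreweras x.1 x.2))}.
Proof.
move=> [pi sg] [pi' sg']; rewrite !inE /= => /and3P[nc1 nc2 ref] /and3P[nc1' nc2' ref'].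
case=> es; rewrite -es in ref' *; move=> e; congr (_, _); apply: kreweras_on_inj => //.
by rewrite -(relative_kreweras_relative_kreweras nc1 nc2 ref) e relative_kreweras_relative_kreweras.
Qed.

(* [(sg, tau) |-> (kreweras_on setT sg, tau)] injects the right-hand side into
   [finer_pairs], so that the injective map [relative_kreweras_inj] is onto. *)
Lemma imset_relative_kreweras :
  [set (x.2, relative_kreweras x.1 x.2) | x in finer_pairs] =
  [set x : {set {set 'I_m}} * {set {set 'I_m}} |
     NC x.1 && (NC x.2 && finer x.2 (kreweras_on setT x.1))].
Proof.
set S' := RHS.
apply/eqP; rewrite eqEcard; apply/andP; split.
  apply/subsetP=> _ /imsetP[[pi sg] + ->]; rewrite !inE /= => /and3P[nc1 nc2 ref].
  by rewrite nc2 NC_relative_kreweras // relative_kreweras_finer_kreweras_on.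
rewrite (card_in_imset relative_kreweras_inj).
have injg : {in S' &,
    injective (fun x : {set {set 'I_m}} * {set {set 'I_m}} => (kreweras_on setT x.1, x.2))}.
  move=> [p q] [p' q']; rewrite !inE /= => /and3P[nc1 _ _] /and3P[nc1' _ _].
  by case=> e ->; congr (_, _); apply: kreweras_on_inj.
rewrite -(card_in_imset injg); apply: subset_leq_card.
apply/subsetP=> _ /imsetP[[p q] + ->]; rewrite !inE /= => /and3P[_ -> ->].
by rewrite !andbT; apply: NC_kreweras_on.
Qed.

End TriplesBijection.

(** * The one-block partition and the partition into singletons *)

Section ExtremalPartitions.
Variable m : nat.
Implicit Types (p : {set {set 'I_m}}) (x y : 'I_m).

Definition coarsest : {set {set 'I_m}} := [set setT].
Definition finest : {set {set 'I_m}} := [set [set x] | x in setT].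

Lemma same_coarsest x y : same coarsest x y.
Proof. by apply/same_existsP; exists setT; rewrite !inE. Qed.

Lemma same_finest x y : same finest x y = (x == y).
Proof.
apply/same_existsP/eqP => [[A [/imsetP[z _ ->]]]|->]; first by rewrite !inE => /eqP-> /eqP->.
by exists [set y]; rewrite !inE eqxx imset_f.
Qed.

Lemma NC_coarsest : 0 < m -> NC coarsest.
Proof.
move=> m0; apply/NConP; split=> [|*]; last exact: same_coarsest.
apply/and3P; split; first by rewrite /cover big_set1.
  exact: trivIset1.
by rewrite inE eq_sym; apply/set0Pn; exists (Ordinal m0).
Qed.

Lemma NC_finest : NC finest.
Proof.
apply/NConP; split=> [|a b c d]; last by rewrite !same_finest => /eqP->; lia.
apply/and3P; split.
- by apply/eqP/setP=> x; rewrite inE; apply/bigcupP; exists [set x]; rewrite ?inE ?imset_f.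
- apply/trivIsetP=> _ _ /imsetP[x _ ->] /imsetP[y _ ->] nxy.
  by rewrite disjoints1 inE; apply: contraNneq nxy => ->.
- by apply/imsetP=> -[x _ /setP/(_ x)]; rewrite !inE eqxx.
Qed.

Lemma kreweras_on_coarsest : 0 < m -> kreweras_on setT coarsest = finest.
Proof.
move=> m0; have /andP[pf _] := NC_finest.
apply: (eq_partition_same (partition_kreweras_on _ _) pf) => x y.
rewrite same_kreweras_on !inE same_finest /=.
apply/idP/eqP => [/kreweras_relP k|->]; last by apply/kreweras_relP.
apply/val_inj/eqP; rewrite eqn_leq /=; apply: contraT => nxy.
have := k x y (same_coarsest x y); have := k y x (same_coarsest y x).
by rewrite /sep; lia.
Qed.

Lemma kreweras_on_finest : 0 < m -> kreweras_on setT finest = coarsest.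
Proof.
move=> m0; have /andP[pc _] := NC_coarsest m0.
apply: (eq_partition_same (partition_kreweras_on _ _) pc) => x y.
rewrite same_kreweras_on !inE same_coarsest /=; apply/kreweras_relP=> u v.
by rewrite same_finest => /eqP->; lia.
Qed.

Lemma kreweras_on_eq_coarsest p : 0 < m -> NC p -> (kreweras_on setT p == coarsest) = (p == finest).
Proof.
move=> m0 ncp; apply/eqP/eqP => [|->]; last exact: kreweras_on_finest.
by rewrite -kreweras_on_finest //; apply: kreweras_on_inj => //; apply: NC_finest.
Qed.

Lemma kreweras_on_eq_finest p : 0 < m -> NC p -> (kreweras_on setT p == finest) = (p == coarsest).
Proof.
move=> m0 ncp; apply/eqP/eqP => [|->]; last exact: kreweras_on_coarsest.
by rewrite -kreweras_on_coarsest //; apply: kreweras_on_inj => //; apply: NC_coarsest.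
Qed.

(** A block of full size would be the only one. Consequently all terms but the one-block term
    involve strictly shorter subwords. *)
Lemma card_block_lt p A : NC p -> p != coarsest -> A \in p -> #|A| < m.
Proof.
move=> /andP[pp _] np pA; have := @proper_card _ (mem A) (mem setT).
rewrite cardsT card_ord properT; apply.
apply: contra np => /eqP eA; apply/eqP/setP=> B; rewrite inE; apply/idP/eqP => [pB|->].
  have /set0Pn[x Bx] := partition_neq0 pp pB.
  rewrite -(def_pblock (partition_trivIset pp) pB Bx).
  by rewrite (def_pblock (partition_trivIset pp) pA) // eA inE.
by rewrite -eA.
Qed.

Lemma partition_finest p : partition p setT -> (forall A, A \in p -> #|A| <= 1) -> p = finest.
Proof.
move=> pp p1; have /andP[pf _] := NC_finest.
apply: (eq_partition_same pp pf) => x y; rewrite same_finest.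
apply/idP/eqP => [/same_existsP[A [pA Ax Ay]]|->]; last by rewrite (same_refl _ pp) inE.
exact: (card_le1_eqP (p1 A pA)).
Qed.

End ExtremalPartitions.

(** * Subwords *)

Section Transport.
Variables (a b : nat) (e : 'I_a -> 'I_b).
Hypothesis e_mono : forall i j, (e i < e j) = (i < j).
Implicit Types (p : {set {set 'I_a}}) (q : {set {set 'I_b}}) (A : {set 'I_a}).

(** Relabelling along an increasing map: positions in a subword are carried to positions in the
    word, and everything defined from order and blocks commutes with it. *)
Definition transport p : {set {set 'I_b}} := [set e @: A | A : {set 'I_a} in p].
Definition transport_inv q : {set {set 'I_a}} := [set e @^-1: B | B : {set 'I_b} in q].

Lemma ltn_mono_inj : injective e.
Proof.
move=> i j eij; apply: val_inj; have := e_mono i j; have := e_mono j i.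
by rewrite eij /=; lia.
Qed.

Lemma transportK : cancel transport transport_inv.
Proof.
move=> p; rewrite /transport_inv /transport -imset_comp -[RHS]imset_id.
apply: eq_imset => A /=; apply/setP=> x; rewrite inE mem_imset //; exact: ltn_mono_inj.
Qed.

Lemma same_transport p x y : same (transport p) (e x) (e y) = same p x y.
Proof.
apply/same_existsP/same_existsP => [[_ [/imsetP[A pA ->] Ax Ay]]|[A [pA Ax Ay]]].
  by exists A; split=> //; rewrite -(mem_imset _ _ ltn_mono_inj).
by exists (e @: A); split; rewrite ?imset_f.
Qed.

Lemma same_transport_codom p x y :
  same (transport p) x y -> exists x' y', x = e x' /\ y = e y'.
Proof.
move=> /same_existsP[_ [/imsetP[A pA ->] /imsetP[x' _ ->] /imsetP[y' _ ->]]].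
by exists x', y'.
Qed.

Lemma partition_transport p A : partition p A -> partition (transport p) (e @: A).
Proof.
move=> pA; apply/and3P; split.
- apply/eqP/setP=> x; apply/bigcupP/imsetP => [[_ /imsetP[B pB ->] /imsetP[y By ->]]|[y]].
    by exists y => //; apply: (subsetP (partitionS pA pB)).
  rewrite -(cover_partition pA) => /bigcupP[B pB By] ->.
  by exists (e @: B); rewrite imset_f.
- apply/trivIsetP=> _ _ /imsetP[B pB ->] /imsetP[C pC ->] nBC.
  have nBC' : B != C by apply: contraNneq nBC => ->.
  have := trivIsetP (partition_trivIset pA) _ _ pB pC nBC'.
  rewrite -!setI_eq0 -imsetI; last by move=> *; apply: ltn_mono_inj.
  by move=> /eqP->; rewrite imset0.
- apply/imsetP=> -[B pB] /esym/eqP; rewrite imset_eq0 => /eqP eB.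
  by move: pB; rewrite eB (partition0 pA).
Qed.

Lemma partition_transport_inv q A : partition q (e @: A) -> partition (transport_inv q) A.
Proof.
move=> pA; apply/and3P; split.
- apply/eqP/setP=> x.
  have <- : (e x \in cover q) = (x \in A).
    by rewrite (cover_partition pA) (mem_imset _ _ ltn_mono_inj).
  apply/bigcupP/bigcupP => [[_ /imsetP[B qB ->]]|[B qB Bx]].
    by rewrite inE => Bx; exists B.
  by exists (e @^-1: B); rewrite ?imset_f // inE.
- apply/trivIsetP=> _ _ /imsetP[B pB ->] /imsetP[C pC ->] nBC.
  have nBC' : B != C by apply: contraNneq nBC => ->.
  have := trivIsetP (partition_trivIset pA) _ _ pB pC nBC'.
  by rewrite -!setI_eq0 -preimsetI => /eqP->; rewrite preimset0.
- apply/imsetP=> -[B pB] /setP eB.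
  have /set0Pn[x Bx] := partition_neq0 pA pB.
  have /imsetP[y _ xy] := subsetP (partitionS pA pB) x Bx.
  by have := eB y; rewrite !inE -xy Bx.
Qed.

Lemma transport_invK q A : partition q (e @: A) -> transport (transport_inv q) = q.
Proof.
move=> pA; rewrite /transport_inv /transport -imset_comp -[RHS]imset_id.
apply: eq_in_imset => B qB /=; apply/setP=> x; apply/imsetP/idP => [[y]|Bx].
  by rewrite inE => ? ->.
have /imsetP[y _ xy] := subsetP (partitionS pA qB) x Bx.
by exists y; rewrite // inE -xy.
Qed.

Lemma NCon_transport p A : NCon (e @: A) (transport p) = NCon A p.
Proof.
apply/NConP/NConP=> -[pp nc]; split.
- by rewrite -(transportK p); apply: partition_transport_inv.
- move=> x y z t; rewrite -!same_transport -!e_mono; exact: nc.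
- exact: partition_transport.
- move=> x0 y0 z0 t0 /[dup]/same_transport_codom[x [z [-> ->]]].
  move=> + /[dup]/same_transport_codom[y [t [-> ->]]].
  by rewrite !same_transport !e_mono; apply: nc.
Qed.

Lemma kreweras_on_transport p A :
  partition p A -> kreweras_on (e @: A) (transport p) = transport (kreweras_on A p).
Proof.
move=> pA; apply: (eq_partition_same (partition_kreweras_on _ _)).
  exact/partition_transport/partition_kreweras_on.
have krT x y : kreweras_rel (transport p) (e x) (e y) = kreweras_rel p x y.
  apply/kreweras_relP/kreweras_relP=> h u v; last first.
    move=> /[dup]/same_transport_codom[u' [v' [-> ->]]].
    by rewrite same_transport /sep !e_mono; apply: h.
  by rewrite -same_transport -e_mono => s l; have := h _ _ s l; rewrite /sep !e_mono.
move=> x y; rewrite same_kreweras_on; apply/and3P/idP => [[]|/[dup]].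
  move=> /imsetP[x' Ax ->] /imsetP[y' Ay ->]; rewrite krT => k.
  by rewrite same_transport same_kreweras_on Ax Ay.
move=> /same_transport_codom[x' [y' [-> ->]]].
by rewrite same_transport same_kreweras_on krT !(mem_imset _ _ ltn_mono_inj) => /and3P.
Qed.

End Transport.

Section Subword.
Variables (s : nat).
Implicit Types (w : seq 'I_s).

Lemma size_subword w (V : {set 'I_(size w)}) : size (subword V) = #|V|.
Proof. by rewrite size_map cardE. Qed.

Lemma sorted_enum_ord m (V : {set 'I_m}) : sorted (relpre (@nat_of_ord m) ltn) (enum V).
Proof.
rewrite {1}/enum_mem sorted_filter //; first by move=> x y z /=; apply: ltn_trans.
by rewrite -enumT -sorted_map val_enum_ord iota_ltn_sorted.
Qed.

Lemma enum_imset_mono a b (e : 'I_a -> 'I_b) (A : {set 'I_a}) :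
  (forall i j, (e i < e j) = (i < j)) -> enum (e @: A) = map e (enum A).
Proof.
move=> e_mono; apply: (@irr_sorted_eq _ (relpre (@nat_of_ord b) ltn)).
- by move=> x y z /=; apply: ltn_trans.
- by move=> x /=; rewrite ltnn.
- exact: sorted_enum_ord.
- rewrite (mono_sorted (e := relpre (@nat_of_ord a) ltn)) ?sorted_enum_ord //.
move=> x; rewrite mem_enum; apply/imsetP/mapP => -[y Ay ->]; exists y => //.
  by rewrite mem_enum.
by move: Ay; rewrite mem_enum.
Qed.

Definition subword_pos w (V : {set 'I_(size w)}) (i : 'I_(size (subword V))) : 'I_(size w) :=
  enum_val (cast_ord (size_subword V) i).

Lemma subword_pos_mono w (V : {set 'I_(size w)}) (i j : 'I_(size (subword V))) :
  (subword_pos i < subword_pos j) = (i < j).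
Proof.
have main (i' j' : 'I_(size (subword V))) : i' < j' -> subword_pos i' < subword_pos j'.
  move=> lt; pose x0 := subword_pos i'.
  rewrite /subword_pos !(enum_val_nth x0) /=.
  have := @sorted_ltn_nth _ (relpre (@nat_of_ord _) ltn) _ x0 (enum V) (sorted_enum_ord V).
  apply=> //; first by move=> x y z /=; apply: ltn_trans.
    by rewrite inE -cardE -size_subword.
  by rewrite inE -cardE -size_subword.
case: (ltngtP i j) => [/main //|/main|/val_inj->]; last by rewrite ltnn.
by lia.
Qed.

Lemma imset_subword_pos w (V : {set 'I_(size w)}) : @subword_pos w V @: setT = V.
Proof.
apply/setP=> x; apply/imsetP/idP => [[i _ ->]|Vx]; first exact: enum_valP.
exists (cast_ord (esym (size_subword V)) (enum_rank_in Vx x)); rewrite // /subword_pos.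
by rewrite cast_ordKV enum_rankK_in.
Qed.

Lemma subword_subword w (V : {set 'I_(size w)}) (A : {set 'I_(size (subword V))}) :
  subword (@subword_pos w V @: A) = subword A.
Proof.
rewrite {1}/subword enum_imset_mono; last exact: subword_pos_mono.
rewrite -map_comp; apply: eq_map => i /=.
have x0 := subword_pos i; set d := tnth (in_tuple w) x0.
rewrite [RHS](tnth_nth d) (nth_map x0) -?cardE -?size_subword //.
by rewrite /subword_pos (enum_val_nth x0).
Qed.

Lemma subword_setT w : subword [set: 'I_(size w)] = w.
Proof. by rewrite /subword (eq_enum (in_setT (T := _))) map_tnth_enum. Qed.

Lemma subword1 w (i : 'I_(size w)) : subword [set i] = [:: tnth (in_tuple w) i].
Proof. by rewrite /subword enum_set1. Qed.

End Subword.

(** * Boxed convolution *)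

Local Open Scope ring_scope.

Section BoxedConvolutionTheory.
Variables (s : nat) (R : comNzRingType).
Implicit Types (w u : seq 'I_s) (f g h : seq 'I_s -> R).

(** The product at the subword on [V], computed with partitions of [V] itself; this avoids index
    types that depend on the length of the subword. *)
Definition boxconv_on f g w (V : {set 'I_(size w)}) : R :=
  \sum_(p | NCon V p) coef_part f p * coef_part g (kreweras_on V p).

Lemma boxconvE f g w : boxconv f g w = boxconv_on f g [set: 'I_(size w)].
Proof. by apply: eq_bigr => p ncp; rewrite krewerasE. Qed.

Lemma coef_part_transport f w (V : {set 'I_(size w)}) p :
  coef_part f (transport (@subword_pos _ w V) p) = coef_part f p.
Proof.
rewrite /coef_part big_imset /=; last first.
  by move=> A B _ _; apply: (imset_inj (ltn_mono_inj (@subword_pos_mono _ w V))).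
by apply: eq_bigr => A _; rewrite subword_subword.
Qed.

Lemma boxconv_subword f g w (V : {set 'I_(size w)}) :
  boxconv f g (subword V) = boxconv_on f g V.
Proof.
have em := @subword_pos_mono _ w V; pose e := @subword_pos _ w V.
have eT : e @: setT = V := imset_subword_pos V.
rewrite boxconvE /boxconv_on.
rewrite (reindex_onto (transport e) (transport_inv e)) /=; last first.
  by move=> q /andP[qV _]; rewrite -eT in qV; apply: transport_invK qV.
apply: eq_big => p.
  by rewrite (transportK em) eqxx andbT; have := NCon_transport em p setT; rewrite eT.
move=> /andP[pp _]; rewrite coef_part_transport -(coef_part_transport g).
by have := kreweras_on_transport em pp; rewrite eT => ->.
Qed.

(** The sets of blocks [F A] are pairwise disjoint, as a common block would be a non-empty subset of
    two blocks of [pi]. *)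
Lemma coef_part_glue f w V (pi : {set {set 'I_(size w)}}) F :
  partition pi V -> (forall A, A \in pi -> partition (F A) A) ->
  coef_part f (\bigcup_(A in pi) F A) = \prod_(A in pi) coef_part f (F A).
Proof.
move=> ppi pF; rewrite /coef_part [\bigcup_(A in pi) F A]big_mkcond /= partition_disjoint_bigcup.
  rewrite [RHS]big_mkcond; apply: eq_bigr => A _; case: ifP => // _.
  by rewrite big_set0.
move=> A B nAB; case: ifP => piA; last by rewrite disjoints_subset sub0set.
case: ifP => piB; last by rewrite disjoint_sym disjoints_subset sub0set.
rewrite -setI_eq0; apply: contraT => /set0Pn[C /setIP[FA FB]].
have /set0Pn[x Cx] := partition_neq0 (pF _ piA) FA.
have := trivIsetP (partition_trivIset ppi) _ _ piA piB nAB.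
rewrite -setI_eq0 => /eqP/setP/(_ x); rewrite !inE.
by rewrite !(subsetP (partitionS (pF _ _) _) _ Cx).
Qed.

(** The product over the blocks of [pi] distributes over the sums; a choice of one non-crossing
    partition in each block glues to a single non-crossing [sg] finer than [pi], and the complements
    glue to the relative complement. *)
Lemma coef_part_boxconv f g w (pi : {set {set 'I_(size w)}}) : NC pi ->
  coef_part (boxconv f g) pi =
  \sum_(sg | NC sg && finer sg pi) coef_part f sg * coef_part g (relative_kreweras pi sg).
Proof.
move=> ncpi; have /andP[ppi _] := ncpi.
rewrite {1}/coef_part; under eq_bigr => V _ do rewrite boxconv_subword.
rewrite /boxconv_on (big_distr_big_dep set0) /=.
(* Outside [pi] the families take the default value [set0] prescribed by the distributivity law. *)
pose rest sg := [ffun V => if V \in pi then sg ::&: V else set0].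
pose glue (ff : {ffun {set 'I_(size w)} -> {set {set 'I_(size w)}}}) := \bigcup_(V in pi) ff V.
have famP ff : ff \in pfamily set0 (mem pi) (fun V => [pred p | NCon V p]) ->
    (forall V, V \in pi -> NCon V (ff V)) /\ (forall V, V \notin pi -> ff V = set0).
  move=> /pfamilyP[/subsetP sup fam]; split; first exact: fam.
  by move=> V; apply: contraNeq => nz; apply: sup; rewrite inE.
rewrite (reindex_onto rest glue) /=; last first.
  move=> ff /famP[fam sup]; apply/ffunP=> V; rewrite ffunE; case: ifP => [piV|/negbT/sup-> //].
  by rewrite (glue_restrict ppi) // => A /fam/andP[].
have restE sg : \bigcup_(V in pi) rest sg V = \bigcup_(V in pi) (sg ::&: V).
  by apply: eq_bigr => V piV; rewrite ffunE piV.
apply: eq_big => sg.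
  apply/andP/andP => [[/famP[fam _] /eqP gl]|[ncsg ref]].
    rewrite -gl; split; first exact: NCon_glue.
    by apply/finerP=> x y; apply: (same_glue ppi) => A /fam/andP[].
  have /andP[psg _] := ncsg; split; last first.
    by rewrite /glue restE (restrict_glue ppi psg) //; apply/finerP.
  apply/pfamilyP; split.
    by apply/subsetP=> V; rewrite inE ffunE; case: ifP => //; rewrite eqxx.
  by move=> V piV; rewrite ffunE piV; apply: NCon_restrict ppi ncsg ref piV.
move=> /andP[/famP[fam _] /eqP gl].
have pF A : A \in pi -> partition (sg ::&: A) A.
  by move=> piA; have /andP[] := fam A piA; rewrite ffunE piA.
rewrite big_split /= (coef_part_glue _ ppi); last by move=> A _; apply: partition_kreweras_on.
congr (_ * _); last by apply: eq_bigr => V piV; rewrite ffunE piV.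
rewrite -{2}gl /glue restE (coef_part_glue _ ppi) //.
by apply: eq_bigr => V piV; rewrite ffunE piV.
Qed.

Lemma boxconvA f g h w :
  boxconv f (boxconv g h) w = boxconv (boxconv f g) h w.
Proof.
rewrite !boxconvE /boxconv_on.
(* The argument of [h] is rewritten as a function of [sg] and the relative complement, so that each
   summand depends on the image of the bijection only. *)
have -> : \sum_(p | NCon [set: 'I_(size w)] p)
    coef_part (boxconv f g) p * coef_part h (kreweras_on setT p) =
  \sum_(x in @finer_pairs (size w)) coef_part f x.2 * (coef_part g (relative_kreweras x.1 x.2) *
     coef_part h (relative_kreweras (kreweras_on setT x.2) (relative_kreweras x.1 x.2))).
  under [RHS]eq_bigl => x do rewrite inE.
  rewrite -(pair_big_dep (fun p => NC p) (fun p q => NC q && finer q p)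
    (fun pi sg => coef_part f sg * (coef_part g (relative_kreweras pi sg) *
        coef_part h (relative_kreweras (kreweras_on setT sg) (relative_kreweras pi sg))))) /=.
  apply: eq_bigr => p ncp; rewrite coef_part_boxconv // big_distrl /=.
  by apply: eq_bigr => q /andP[ncq ref]; rewrite relative_kreweras_relative_kreweras // mulrA.
(* After reindexing, both sides sum over the pairs with [tau] finer than the complement of [sg]. *)
rewrite -(big_imset (fun y => coef_part f y.1 * (coef_part g y.2 *
     coef_part h (relative_kreweras (kreweras_on setT y.1) y.2)))
  (@relative_kreweras_inj _)) imset_relative_kreweras.
under [RHS]eq_bigl => x do rewrite inE.
rewrite -(pair_big_dep (fun p => NC p) (fun p q => NC q && finer q (kreweras_on setT p))
    (fun sg tau => coef_part f sg * (coef_part g tau *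
        coef_part h (relative_kreweras (kreweras_on setT sg) tau)))) /=.
apply: eq_bigr => p ncp; rewrite coef_part_boxconv ?big_distrr //; exact: NC_kreweras_on.
Qed.

End BoxedConvolutionTheory.

(** * Dependence of a product on its top coefficients, and the unit series *)

Section Perturbation.
Variables (s : nat) (R : comNzRingType).
Implicit Types (w u : seq 'I_s) (f g h : seq 'I_s -> R).

Definition agree_below w f g := forall u, (0 < size u < size w)%N -> f u = g u.

Lemma coef_part_coarsest f w : coef_part f (coarsest (size w)) = f w.
Proof. by rewrite /coef_part big_set1 subword_setT. Qed.

Lemma coef_part_finest f w : coef_part f (finest (size w)) = \prod_(i <- w) f [:: i].
Proof.
rewrite /coef_part big_imset /=; last by move=> i j _ _; apply: set1_inj.
rewrite [RHS](big_tnth _ _ w) /=.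
by apply: eq_big => [i|i _]; rewrite ?inE // subword1.
Qed.

Lemma coef_part_below f g w (p : {set {set 'I_(size w)}}) :
  agree_below w f g -> NC p -> p != coarsest _ -> coef_part f p = coef_part g p.
Proof.
move=> fg ncp np; apply: eq_bigr => A pA; have /andP[pp _] := ncp.
apply: fg; rewrite size_subword card_gt0 (partition_neq0 pp pA) /=.
exact: card_block_lt pA.
Qed.

Lemma coef_part_agree f g w (p : {set {set 'I_(size w)}}) :
  agree_below w f g -> f w = g w -> NC p -> coef_part f p = coef_part g p.
Proof.
move=> fg fgw ncp; have [->|np] := eqVneq p (coarsest _).
  by rewrite !coef_part_coarsest.
exact: coef_part_below.
Qed.

Lemma boxconv_agree f f' g g' w :
  agree_below w f f' -> f w = f' w -> agree_below w g g' -> g w = g' w ->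
  boxconv f g w = boxconv f' g' w.
Proof.
move=> ff ffw gg ggw; rewrite !boxconvE; apply: eq_bigr => p ncp.
by rewrite (coef_part_agree ff) // (coef_part_agree gg) //; apply: NC_kreweras_on.
Qed.

(** Only the one-block partition sees the value at [w] of the left factor, and its complement
    consists of singletons; all other terms cancel in the difference. *)
Lemma boxconv_subl f f' g w : (0 < size w)%N -> agree_below w f f' ->
  boxconv f g w - boxconv f' g w = (f w - f' w) * \prod_(i <- w) g [:: i].
Proof.
move=> w0 ff; rewrite !boxconvE -sumrB (bigD1 (coarsest _)) /=; last exact: NC_coarsest.
rewrite big1 => [|p /andP[ncp np]]; last by rewrite (coef_part_below ff) // subrr.
by rewrite addr0 -mulrBl kreweras_on_coarsest // !coef_part_coarsest coef_part_finest.
Qed.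

(** Symmetrically, the value at [w] of the right factor enters only when the complement has one
    block, that is for the partition into singletons. *)
Lemma boxconv_subr f g g' w : (0 < size w)%N -> agree_below w g g' ->
  boxconv f g w - boxconv f g' w = (\prod_(i <- w) f [:: i]) * (g w - g' w).
Proof.
move=> w0 gg; rewrite !boxconvE -sumrB (bigD1 (finest _)) /=; last exact: NC_finest.
rewrite big1 => [|p /andP[ncp np]]; last first.
  rewrite (coef_part_below gg) ?subrr //; first exact: NC_kreweras_on.
  by rewrite kreweras_on_eq_coarsest.
by rewrite addr0 -mulrBr kreweras_on_finest // !coef_part_coarsest coef_part_finest.
Qed.

Definition unit_series w : R := (size w == 1)%:R.

(** A block with more than one point contributes a factor zero. *)
Lemma coef_part_unit w (p : {set {set 'I_(size w)}}) :
  NC p -> coef_part unit_series p = (p == finest _)%:R.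
Proof.
move=> ncp; have [->|np] := eqVneq p (finest _).
  by rewrite coef_part_finest big1.
have /andP[pp _] := ncp.
have [A pA A1] : exists2 A, A \in p & #|A| != 1%N.
  apply/exists_inP; apply: contraNT np => /exists_inPn p1; apply/eqP/partition_finest => // A pA.
  by rewrite (eqP (negbNE (p1 A pA))).
by rewrite /coef_part (bigD1 A) //= /unit_series size_subword (negbTE A1) mul0r.
Qed.

Lemma boxconv_1l g w : (0 < size w)%N -> boxconv unit_series g w = g w.
Proof.
move=> w0; rewrite boxconvE /boxconv_on (bigD1 (finest _)) /=; last exact: NC_finest.
rewrite big1 => [|p /andP[ncp np]]; last by rewrite coef_part_unit // (negbTE np) mul0r.
by rewrite addr0 coef_part_unit ?NC_finest // eqxx mul1r kreweras_on_finest // coef_part_coarsest.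
Qed.

Lemma boxconv_1r g w : (0 < size w)%N -> boxconv g unit_series w = g w.
Proof.
move=> w0; rewrite boxconvE /boxconv_on (bigD1 (coarsest _)) /=; last exact: NC_coarsest.
rewrite big1 => [|p /andP[ncp np]]; last first.
  by rewrite coef_part_unit ?NC_kreweras_on // kreweras_on_eq_finest // (negbTE np) mulr0.
rewrite addr0 kreweras_on_coarsest // coef_part_unit ?NC_finest // eqxx mulr1.
by rewrite coef_part_coarsest.
Qed.

End Perturbation.

(** * The monoid of truncated series *)

Section TruncatedSeries.
Variables (s n : nat) (R : comNzRingType).
Implicit Types (f g h : tseries s n R) (w v : word s n) (u : seq 'I_s).

Definition letters w : seq 'I_s := val (val w).

Lemma size_letters w : (0 < size (letters w) <= n)%N.
Proof. by rewrite (valP w) size_bseq. Qed.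

Lemma word_of u : (0 < size u <= n)%N -> exists w, letters w = u.
Proof.
move=> /andP[u0 un]; have h : (0 < size (insub_bseq n u))%N.
  by rewrite /insub_bseq val_insubd un.
by exists (Sub (insub_bseq n u) h); rewrite /letters SubK /insub_bseq val_insubd un.
Qed.

Lemma coef_letters f w : coef f (letters w) = f w.
Proof. by rewrite /coef /letters !valK /= valK. Qed.

Lemma coef_box f g u : (0 < size u <= n)%N ->
  coef (box f g) u = boxconv (coef f) (coef g) u.
Proof. by move=> /word_of[w <-]; rewrite coef_letters ffunE. Qed.

Lemma coef_box1 u : (0 < size u <= n)%N -> coef (@box1 s n R) u = unit_series R u.
Proof. by move=> /word_of[w <-]; rewrite coef_letters ffunE. Qed.

(** A product coefficient at [w] involves only [w] and shorter words, so for such a set [D] the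
    coefficients in [D] of a product depend only on those of its factors. *)
Definition size_closed (D : pred (word s n)) :=
  forall w v, D w -> (size (letters v) < size (letters w))%N -> D v.

Lemma agree_below_coef (D : pred (word s n)) f g w :
  (forall v, (size (letters v) < size (letters w))%N -> D v) ->
  {in D, f =1 g} -> agree_below (letters w) (coef f) (coef g).
Proof.
move=> cD fg u /andP[u0 uw]; have /andP[_ wn] := size_letters w.
have [v vu] : exists v, letters v = u by apply: word_of; rewrite u0 (ltnW (leq_trans uw wn)).
by rewrite -vu !coef_letters fg //; apply: cD; rewrite vu.
Qed.

Lemma box_agree (D : pred (word s n)) f f' g g' :
  size_closed D -> {in D, f =1 f'} -> {in D, g =1 g'} -> {in D, box f g =1 box f' g'}.
Proof.
move=> cD ff gg w Dw; rewrite !ffunE; have cDw v := cD w v Dw.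
apply: boxconv_agree; rewrite -?/(letters w) ?coef_letters ?ff ?gg //.
  exact: agree_below_coef ff.
exact: agree_below_coef gg.
Qed.

Lemma boxA f g h : box f (box g h) = box (box f g) h.
Proof.
apply/ffunP=> w; rewrite !ffunE -/(letters w).
have /andP[w0 wn] := size_letters w.
(* [coef] vanishes beyond length [n], so a truncated product agrees with the full one only on words
   up to that length; this suffices at [w]. *)
have ag f1 f2 : agree_below (letters w) (coef (box f1 f2)) (boxconv (coef f1) (coef f2)).
  by move=> u /andP[u0 uw]; apply: coef_box; rewrite u0 (ltnW (leq_trans uw wn)).
rewrite (boxconv_agree (f' := coef f) (g' := boxconv (coef g) (coef h))) ?coef_box ?w0 //.
rewrite [RHS](boxconv_agree (f' := boxconv (coef f) (coef g)) (g' := coef h)) ?coef_box ?w0 //.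
exact: boxconvA.
Qed.

Lemma box1x f : box box1 f = f.
Proof.
apply/ffunP=> w; rewrite ffunE -/(letters w) -[RHS]coef_letters.
have /andP[w0 wn] := size_letters w; rewrite -[RHS]boxconv_1l //.
apply: boxconv_agree; rewrite ?coef_box1 ?w0 // => u /andP[u0 uw].
by rewrite coef_box1 // u0 (ltnW (leq_trans uw wn)).
Qed.

Lemma boxx1 f : box f box1 = f.
Proof.
apply/ffunP=> w; rewrite ffunE -/(letters w) -[RHS]coef_letters.
have /andP[w0 wn] := size_letters w; rewrite -[RHS]boxconv_1r //.
apply: boxconv_agree; rewrite ?coef_box1 ?w0 // => u /andP[u0 uw].
by rewrite coef_box1 // u0 (ltnW (leq_trans uw wn)).
Qed.

Lemma box_subl f f' g w :
  (forall v, (size (letters v) < size (letters w))%N -> f v = f' v) ->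
  box f g w - box f' g w = (f w - f' w) * \prod_(i <- letters w) coef g [:: i].
Proof.
move=> ff; have /andP[w0 _] := size_letters w.
rewrite !ffunE -/(letters w) boxconv_subl ?coef_letters //.
by apply: (@agree_below_coef (fun v => (size (letters v) < size (letters w))%N)).
Qed.

Lemma box_subr f g g' w :
  (forall v, (size (letters v) < size (letters w))%N -> g v = g' v) ->
  box f g w - box f g' w = (\prod_(i <- letters w) coef f [:: i]) * (g w - g' w).
Proof.
move=> ff; have /andP[w0 _] := size_letters w.
rewrite !ffunE -/(letters w) boxconv_subr ?coef_letters //.
by apply: (@agree_below_coef (fun v => (size (letters v) < size (letters w))%N)).
Qed.

(** The left factor is compared with the unit series; there are no non-empty words shorter than one
    letter. *)
Lemma box_letter f g i : (0 < n)%N ->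
  coef (box f g) [:: i] = coef f [:: i] * coef g [:: i].
Proof.
move=> n0; rewrite coef_box ?n0 //.
have := @boxconv_subl _ _ (coef f) (unit_series R) (coef g) [:: i] isT.
rewrite boxconv_1l // big_seq1 mulrBl mul1r => e.
by rewrite -[LHS](subrK (coef g [:: i])) e ?subrK //; case=> [|? []].
Qed.

End TruncatedSeries.

(** * Inverses of series with invertible linear coefficients *)

Section Inverse.
Variables (s n : nat) (R : comUnitRingType).
Implicit Types (f g : tseries s n R).

Definition unit_letters f := forall i : 'I_s, coef f [:: i] \is a GRing.unit.

Lemma unit_letters1 : (0 < n)%N -> unit_letters (@box1 s n R).
Proof. by move=> n0 i; rewrite coef_box1 ?n0 // unitr1. Qed.

Lemma unit_lettersM f g : (0 < n)%N ->
  unit_letters f -> unit_letters g -> unit_letters (box f g).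
Proof. by move=> n0 uf ug i; rewrite box_letter // unitrM uf ug. Qed.

Lemma unit_letters_box_r f g : (0 < n)%N -> unit_letters (box f g) -> unit_letters g.
Proof. by move=> n0 h i; move: (h i); rewrite box_letter // unitrM => /andP[]. Qed.

(** Induction on word length: by [box_subr] each new coefficient of [g] solves a linear equation
    whose leading coefficient is a product of units. *)
Lemma box_right_inverse f : unit_letters f -> exists g, box f g = box1.
Proof.
move=> uf.
suff /(_ n)[g gP] : forall l, exists g, forall w, (size (letters w) <= l)%N -> box f g w = box1 w.
  exists g; apply/ffunP=> w; apply: gP.
  by have /andP[] := size_letters w.
elim=> [|l [g gP]].
  by exists box1 => w; have /andP[+ _] := size_letters w; rewrite ltnNge => /negbTE->.
(* Correcting [g] in length [l.+1] alone leaves shorter coefficients of the product intact and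
   cancels the defect in this length. *)
pose g' : tseries s n R := [ffun w => g w + if size (letters w) == l.+1 then
  (\prod_(i <- letters w) coef f [:: i])^-1 * (box1 w - box f g w) else 0].
have gg v : (size (letters v) <= l)%N -> g' v = g v.
  by move=> vl; rewrite ffunE ifF ?addr0 //; apply/negbTE; rewrite neq_ltn ltnS vl.
exists g' => w; rewrite leq_eqVlt => /orP[/eqP wl|]; last first.
  rewrite ltnS => wl; rewrite -gP //.
  apply: (@box_agree _ _ _ (fun v => (size (letters v) <= l)%N)) => //.
  by move=> x v xl /ltnW vx; apply: leq_trans xl.
apply: (addIr (- box f g w)); rewrite box_subr => [|v]; last by rewrite wl ltnS => /gg.
rewrite [g' w]ffunE wl eqxx [g w + _]addrC addrK mulrA mulrV ?mul1r //.
by apply: rpred_prod => i _; apply: uf.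
Qed.

(** A right inverse [g] again has unit letters, hence a right inverse of its own, which
    associativity identifies with [f]. *)
Lemma box_inverse f : (0 < n)%N -> unit_letters f ->
  exists g, [/\ unit_letters g, box f g = box1 & box g f = box1].
Proof.
move=> n0 uf; have [g fg] := box_right_inverse uf.
have ug : unit_letters g.
  by apply: (@unit_letters_box_r f) => //; rewrite fg; apply: unit_letters1.
have [h gh] := box_right_inverse ug.
have hf : h = f by rewrite -[f]boxx1 -gh boxA fg box1x.
by exists g; split=> //; rewrite -gh hf.
Qed.

End Inverse.

(** * The subnormal series *)

Section CongruenceSubgroups.
Variables (s n : nat) (n0 : (0 < n)%N) (R : comUnitRingType).
Implicit Types (f g x y z : tseries s n R) (D : pred (word s n)).

Definition congruence D f := unit_letters f /\ {in D, f =1 box1}.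

Lemma congruence1 D : congruence D box1.
Proof. by split=> //; apply: unit_letters1. Qed.

Lemma congruenceM D x y :
  size_closed D -> congruence D x -> congruence D y -> congruence D (box x y).
Proof.
move=> cD [ux Dx] [uy Dy]; split; first exact: unit_lettersM.
by move=> w Dw; rewrite (box_agree cD Dx Dy Dw) box1x.
Qed.

Lemma congruenceV D x : size_closed D -> congruence D x ->
  exists y, [/\ congruence D y, box x y = box1 & box y x = box1].
Proof.
move=> cD [ux Dx]; have [y [uy xy yx]] := box_inverse n0 ux.
exists y; split=> //.
(* On [D], [x] agrees with [box1], so there [y], which is [box box1 y], agrees with [box x y]. *)
split=> // w Dw; rewrite -xy -{1}[y]box1x.
by apply: (box_agree cD) Dw => // v Dv; rewrite Dx.
Qed.

Lemma group_on_congruence D : size_closed D -> group_on (@box s n R) box1 (congruence D).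
Proof.
move=> cD; split.
- exact: congruence1.
- by move=> x y; apply: congruenceM.
- by move=> *; apply: boxA.
- by move=> *; apply: box1x.
- by move=> *; apply: boxx1.
- by move=> x; apply: congruenceV.
Qed.

(** Modulo [D] the factor [y] is the unit, so the conjugate reduces to [box x x'], the unit. *)
Lemma normal_on_congruence D (H : tseries s n R -> Prop) : size_closed D ->
  (forall x, H x -> unit_letters x) ->
  normal_on (@box s n R) box1 (congruence D) H.
Proof.
move=> cD uH x x' y Hx Hx' xx' _ [uy Dy]; split.
  by apply: unit_lettersM (uH _ Hx') => //; apply: unit_lettersM (uH _ Hx) uy.
have Dxy : {in D, box x y =1 box x box1} by apply: box_agree.
by move=> w Dw; rewrite (box_agree (f' := box x box1) (g' := x') cD _ _ Dw) // boxx1 xx'.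
Qed.

(** Right multiplication by an element of the subgroup does not change coefficients in [D].
    Conversely, if [x] and [y] agree on [D], multiplying by the inverse of [y] turns a member of the
    coset of [x] into an element of the subgroup. *)
Lemma lcoset_congruence D x y : size_closed D -> unit_letters x -> unit_letters y ->
  {in D, x =1 y} <->
  (forall z, lcoset_on (@box s n R) (congruence D) x z <->
             lcoset_on (@box s n R) (congruence D) y z).
Proof.
move=> cD ux uy.
have sub x1 y1 : unit_letters x1 -> unit_letters y1 -> {in D, x1 =1 y1} ->
    forall z, lcoset_on (@box s n R) (congruence D) x1 z ->
              lcoset_on (@box s n R) (congruence D) y1 z.
  move=> ux1 uy1 e _ [v [uv Dv] ->].
  have [y' [uy' yy' y'y]] := box_inverse n0 uy1.
  exists (box y' (box x1 v)); last by rewrite boxA yy' box1x.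
  split; first by apply: unit_lettersM uy' _ => //; apply: unit_lettersM ux1 uv.
  have Dxv : {in D, box x1 v =1 box y1 box1} by apply: box_agree.
  by move=> w Dw; rewrite (box_agree (f' := y') (g' := box y1 box1) cD _ _ Dw) // boxx1 y'y.
split=> [e z|e]; first by split; apply: sub => // w Dw; rewrite e.
have [z [_ Dz] ->] : lcoset_on (@box s n R) (congruence D) y x.
  by apply/e; exists box1; [apply: congruence1 | rewrite boxx1].
by move=> w Dw; rewrite (box_agree (f' := y) (g' := box1) cD _ _ Dw) // boxx1.
Qed.

End CongruenceSubgroups.

(** * The filtration by words in order of length, and its quotients *)

Section Series.
Variables (k : fieldType) (s n : nat) (n0 : (0 < n)%N).
Implicit Types (R : comUnitAlgType k) (v w : word s n).

Definition sorted_words : seq (word s n) :=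
  sort (relpre (fun w => size (letters w)) leq) (enum {: word s n}).

Lemma mem_sorted_words w : w \in sorted_words.
Proof. by rewrite mem_sort mem_enum. Qed.

Lemma size_sorted_words : size sorted_words = #|{: word s n}|.
Proof. by rewrite size_sort cardE. Qed.

Lemma index_sorted_words v w : (size (letters v) < size (letters w))%N ->
  (index v sorted_words < index w sorted_words)%N.
Proof.
pose shorter := relpre (fun w => size (letters w)) leq.
have sh_tr : transitive shorter by move=> x y z; apply: leq_trans.
have sh_refl : reflexive shorter by move=> x; apply: leqnn.
have sh_total : total shorter by move=> x y; apply: leq_total.
apply: contraTT; rewrite -!leqNgt.
move=> /(sorted_leq_nth sh_tr sh_refl w (sort_sorted sh_total (enum {: word s n}))).
by rewrite !inE !index_mem !mem_sorted_words !nth_index ?mem_sorted_words //; apply.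
Qed.

Definition first_words i : pred (word s n) := fun w => (index w sorted_words < i)%N.

Lemma size_closed_first_words i : size_closed (first_words i).
Proof. by move=> w v + /index_sorted_words h; apply: ltn_trans. Qed.

Definition series_step i : subfunctor k s n :=
  fun R f => congruence (first_words i) f.

Lemma closed_series_step i : closed_subscheme (series_step i).
Proof.
(* The equations set each coordinate among the first [i] words to its value in the unit series;
   [in_alg] preserves these constants, which are 0 or 1. *)
exists (fun P => exists2 w, first_words i w &
  P = 'X_(enum_rank (inl w : Gvar s n)) - (box1 w)%:MP_[_]) => R f.
have evalE w : regular_eval f ('X_(enum_rank (inl w : Gvar s n)) - (box1 w)%:MP_[_]) = f w - box1 w.
  rewrite /regular_eval mmapB mmapX mmap1U mmapC enum_rankK /=; congr (_ - _).
  by rewrite !ffunE /= scaler_nat.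
split=> [[uf Df]|[uf If]]; split=> //.
  by move=> _ [w Dw ->]; rewrite evalE Df // subrr.
by move=> w Dw; apply/eqP; rewrite -subr_eq0 -evalE; apply/eqP/If; exists w.
Qed.

Lemma closed_subgroup_series_step i : closed_subgroup_scheme (series_step i).
Proof.
split=> [|R]; first exact: closed_series_step.
split=> [f []|] //.
exact/group_on_congruence/size_closed_first_words.
Qed.

Section Quotient.
Variables (w : word s n).
Let i := index w sorted_words.

Lemma first_wordsS v : (v \in first_words i.+1) = (v \in first_words i) || (v == w).
Proof.
rewrite !unfold_in ltnS leq_eqVlt orbC; congr (_ || _).
apply/eqP/eqP => [e|-> //].
by rewrite -[v](nth_index w (mem_sorted_words v)) e nth_index ?mem_sorted_words.
Qed.

(** The coefficient at [w] serves as the isomorphism. Passing to the next subgroup constrains just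
    this one coefficient more, so within the larger subgroup two cosets coincide exactly when it
    does. *)
Lemma quotient_coordinate (A : forall R, pred R) (op : forall R, R -> R -> R) :
  (forall R f, series_step i f -> A R (f w)) ->
  (forall R a, A R a -> exists2 f, series_step (R := R) i f & f w = a) ->
  (forall R x y, series_step (R := R) i x -> series_step i y ->
     box x y w = op R (x w) (y w)) ->
  quotient_isomorphic (series_step i) (series_step i.+1) A op.
Proof.
move=> hA hsurj hop; exists (fun R f => f w); split=> [R|R S h x _]; last by rewrite ffunE.
split=> // [x|a|x y|x y [ux Dx] [uy Dy]]; [exact: hA|exact: hsurj|exact: hop|].
rewrite -lcoset_congruence //; last exact: size_closed_first_words.
split=> [e v|e]; last by apply: e; rewrite first_wordsS eqxx orbT.
by rewrite first_wordsS => /orP[Dv|/eqP->] //; rewrite Dx ?Dy.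
Qed.

(** All words shorter than [w] come before it, so [x] agrees with [box1] on them and [box_subl]
    applies. *)
Lemma series_step_box R x y : series_step (R := R) i x -> series_step i y ->
  box x y w = (x w - box1 w) * \prod_(a <- letters w) coef y [:: a] + y w.
Proof.
move=> [ux Dx] [uy Dy]; rewrite -box_subl => [|v vw]; first by rewrite box1x subrK.
by apply: Dx; apply: index_sorted_words.
Qed.

(** A preimage of [a] under the coordinate at [w]. *)
Definition perturb R (a : R) : tseries s n R := [ffun v => if v == w then a else box1 v].

Lemma series_step_perturb R (a : R) :
  (size (letters w) == 1%N -> a \is a GRing.unit) -> series_step i (perturb a).
Proof.
move=> ua; split=> [b|v Dv]; last first.
  by rewrite ffunE ifF //; apply: contraTF Dv => /eqP->; rewrite unfold_in /first_words ltnn.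
have [v vb] : exists v : word s n, letters v = [:: b] by apply: word_of; rewrite n0.
rewrite -vb coef_letters ffunE; case: eqP => [vw|_]; first by apply: ua; rewrite -vw vb.
by rewrite ffunE -/(letters v) vb unitr1.
Qed.

(** For a single letter, [series_step_box] reduces to the product of the two coefficients. For a
    longer word, the unit coefficient at [w] is 0 and all letters precede [w], so the product of the
    coefficients of [y] at letters is 1 and a sum remains. *)
Lemma quotient_step :
  quotient_Ga (series_step i) (series_step i.+1) \/
  quotient_Gm (series_step i) (series_step i.+1).
Proof.
have [w1|w1] := eqVneq (size (letters w)) 1%N; [right|left]; apply: quotient_coordinate.
- move=> R f [uf _]; case: (letters w) w1 (coef_letters f w) => [|a []] // _ <-.
  exact: uf.
- move=> R a ua; exists (perturb a); last by rewrite ffunE eqxx.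
  exact: series_step_perturb.
- move=> R x y Hx Hy; rewrite series_step_box // ffunE -/(letters w) w1 eqxx.
  rewrite -(coef_letters y w); case: (letters w) w1 => [|a []] // _.
  by rewrite big_seq1 mulrBl mul1r subrK.
- by [].
- move=> R a _; exists (perturb a); last by rewrite ffunE eqxx.
  by apply: series_step_perturb; rewrite (negbTE w1).
- move=> R x y Hx Hy; rewrite series_step_box // ffunE -/(letters w) (negbTE w1) subr0.
  rewrite big1_seq ?mulr1 // => a _.
  have [v va] : exists v : word s n, letters v = [:: a] by apply: word_of; rewrite n0.
  case: Hy => _ Dy; rewrite -va coef_letters Dy; first by rewrite ffunE -/(letters v) va.
  apply: index_sorted_words; rewrite va /= ltn_neqAle eq_sym w1 /=.
  by have /andP[] := size_letters w.
Qed.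

End Quotient.

End Series.

Theorem corollary6p7 (k : fieldType) (s n : nat)
  (hs : (1 <= s)%N) (hn : (1 <= n)%N) : split_solvable k s n.
Proof.
exists #|{: word s n}|, (@series_step k s n); split.
- by move=> R f; split=> [[]|uf] //; split.
- move=> R f; split=> [[_ fD]|->]; last exact: congruence1.
  apply/ffunP=> w; apply: fD.
  by rewrite unfold_in /first_words -size_sorted_words index_mem mem_sorted_words.
- by move=> i _; apply: closed_subgroup_series_step.
move=> i; rewrite -size_sorted_words => isz.
(* A default word for [nth]; the list is non-empty because [i] is below its length. *)
have [w0 _] : exists w0 : word s n, true.
  by case: (sorted_words s n) isz => // w0 *; exists w0.
pose w := nth w0 (sorted_words s n) i.
have iE : i = index w (sorted_words s n).
  by rewrite index_uniq // sort_uniq enum_uniq.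
split.
- by move=> R f [uf Df]; split=> // v Dv; apply: Df; apply: ltnW.
- by move=> R; apply: normal_on_congruence => [||x []] //; apply: size_closed_first_words.
- by rewrite iE; apply: quotient_step.
Qed.
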